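(* Let $n \geq 3$ be an integer. (1) $\mathcal{J}(S_n) \leq 5/2$ with equality if and only if $n=4$, and $\mathcal{J}(S_n) < 2$ for all $n \geq 7$. (2) $\mathcal{J}(A_n) \leq 11/6$ with equality if and only if $n=4$, and $\mathcal{J}(A_n) < 4/3$ for all $n \geq 9$. In particular, $A_n$ is HS.
   Context: $S_n$ and $A_n$ denote the symmetric and alternating groups of degree $n$. For a finite group $G$, let $m_1,\ldots,m_k$ be the indices of the subgroups of $G$ (including $\{1\}$ and $G$), counted without multiplicity, so that $m_i \neq m_j$ for $i \neq j$. Define $\mathcal{J}(G) := \sum_{i=1}^k \frac{1}{m_i}$. A finite group $G$ is called HS if it satisfies the Herzog-Schönheim conjecture: whenever $k \geq 2$, $H_1,\ldots,H_k$ are proper subgroups of $G$ and $x_1,\ldots,x_k \in G$ are such that $G$ is the disjoint union of the cosets $H_1x_1,\ldots,H_kx_k$, then $[G:H_i]=[G:H_j]$ for some $i \neq j$. *)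

(* Defs.v *)
From HB Require Import structures.
From mathcomp Require Import all_boot all_order all_algebra.
From mathcomp Require Import all_fingroup all_solvable.

Set Implicit Arguments.
Unset Strict Implicit.
Unset Printing Implicit Defensive.

Import Order.TTheory GRing.Theory Num.Theory.

Definition subgroup_indices (gT : finGroupType) (G : {group gT}) : seq nat :=
  undup [seq #|G : H|%g | H : {group gT} in subgroups G].

Definition J (gT : finGroupType) (G : {group gT}) : rat :=
  (\sum_(m <- subgroup_indices G) (m%:R)^-1)%R.

Definition HS (gT : finGroupType) (G : {group gT}) : Prop :=
  forall (k : nat) (H : 'I_k -> {group gT}) (x : 'I_k -> gT),
    2 <= k ->
    (forall i, H i \proper G) ->
    (forall i, x i \in G) ->
    (forall i j, i != j -> [disjoint (H i :* x i)%g & (H j :* x j)%g]) ->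
    \bigcup_(i < k) (H i :* x i)%g = G ->
    exists i j, i != j /\ #|G : H i|%g = #|G : H j|%g.

(* Main.v *)
Require Import Defs.
From Stdlib Require Import NArith.
From HB Require Import structures.
From mathcomp Require Import all_boot all_order all_algebra.
From mathcomp Require Import all_fingroup all_solvable.
From mathcomp Require Import zify.

Set Implicit Arguments.
Unset Strict Implicit.
Unset Printing Implicit Defensive.

(** For a subgroup [H] of [G] one has [1 / #|G : H| = #|H| / #|G|], so
    [J G * #|G|] is the sum of the distinct orders of the subgroups of [G], and
    every assertion bounds such a sum for a group of permutations of [n] points.
    The conjecture of Herzog and Schoenheim holds as soon as [J G < 2]: disjoint
    cosets of proper subgroups with different orders that cover [G] have orders
    adding up to [#|G|], and together with [#|G|] itself these distinct orders
    would sum to [2 * #|G|].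

    The orders are controlled through the three-cycles in a permutation group
    [G].  Two points are linked when some three-cycle of [G] carries one to the
    other.  This is an equivalence relation ([linked_trans]); [G] permutes its
    classes, and contains the alternating group of each class ([Alt_cls_dvd]).
    Hence there are three possibilities ([class_trichotomy]).
     - [G] is a giant: it has a class of [k > n / 2] points, which is then
       unique and stabilised by [G], so that the order of [G] is [k`! / 2] times
       a divisor of [2 * (n - k)`!].
     - All classes have at most [n / 2] points and some class has at least
       three.  Stripping off the classes in the order of their sizes bounds
       the order of [G] ([strip_classes], [cap_bound]).
     - [G] contains no three-cycle.  Then Bochert's argument applies
       ([cyc3_free_bound]): the order of [G] is at most [n`! / (uphalf n)`!].

    For [n] from 5 to 25 the orders that these conditions admit are summed by
    computation ([check_bound_true]).  For small [n] this needs sharper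
    information on groups without three-cycles: an element whose order is a
    prime [p > n / 2] makes a group highly transitive on an orbit
    ([long_cycle_orbit]), and on seven and eight points the orders are at
    most 168 and 1344 ([max_freeP]).

    For [n >= 26], writing [c] for the index in the symmetric group of the group
    whose subgroups are considered, the symmetric and alternating groups
    contribute [3 / 2 * n`!] for [c = 1] and [n`! / 2] for [c = 2], and the
    other giants at most [n`! / (5 * c ^ 2)] ([giant_terms]).  All other orders
    are at most [2 * (n./2)`! * (uphalf n)`!] ([giant_or_small]), and there
    are at most as many of them as divisors of [n`!], which is little compared
    with the central binomial coefficient ([tau_fact_central]): multiplying
    [n.-1`!] by [n] multiplies the number of divisors by at most 2, and
    by at most [15 / 8] when [n] is composite, while the coefficient grows like
    [2 ^ n].  So these orders add up to at most [11 / 100 * n`!].  The degrees 3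
    and 4 are treated by hand. *)

Import GroupScope.

(** * Three-cycles and linked points *)

Section ThreeCycles.

Variable T : finType.
Implicit Types (a b c d e u v : T) (s t x y : {perm T}) (S D : {set T}).
Implicit Types G H K : {group {perm T}}.

Definition cyc3 a b c : {perm T} := tperm a b * tperm a c.

Lemma cyc3J a b c s : cyc3 a b c ^ s = cyc3 (s a) (s b) (s c).
Proof. by rewrite conjMg !tpermJ. Qed.

Lemma cyc3V a b c : (cyc3 a b c)^-1 = cyc3 a c b.
Proof. by rewrite invMg !tpermV. Qed.

Lemma uniq3P a b c : uniq [:: a; b; c] = [&& a != b, a != c & b != c].
Proof. by rewrite /= !inE !negb_or !andbT andbA. Qed.

Lemma cyc3_1 a b c : uniq [:: a; b; c] -> cyc3 a b c a = b.
Proof.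
rewrite uniq3P => /and3P[ab ac bc].
by rewrite permM tpermL tpermD // eq_sym.
Qed.

Lemma cyc3_2 a b c : cyc3 a b c b = c.
Proof. by rewrite permM tpermR tpermL. Qed.

Lemma cyc3_3 a b c : uniq [:: a; b; c] -> cyc3 a b c c = a.
Proof.
rewrite uniq3P => /and3P[ab ac bc].
by rewrite permM (tpermD ac bc) tpermR.
Qed.

Lemma cyc3_out a b c u : u != a -> u != b -> u != c -> cyc3 a b c u = u.
Proof.
by rewrite !(eq_sym u) => ua ub uc; rewrite permM (tpermD ua ub) (tpermD ua uc).
Qed.

Lemma cyc3_eq a b c s : uniq [:: a; b; c] -> s a = b -> s b = c -> s c = a ->
  (forall u, u != a -> u != b -> u != c -> s u = u) -> s = cyc3 a b c.
Proof.
move=> U sa sb sc so; apply/permP=> u.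
have [->|ua] := eqVneq u a; first by rewrite cyc3_1.
have [->|ub] := eqVneq u b; first by rewrite cyc3_2.
have [->|uc] := eqVneq u c; first by rewrite cyc3_3.
by rewrite cyc3_out // so.
Qed.

Lemma uniq3_rot a b c : uniq [:: a; b; c] -> uniq [:: b; c; a].
Proof. by rewrite -(rot_uniq 1 [:: a; b; c]). Qed.

Lemma uniq3_rev a b c : uniq [:: a; b; c] -> uniq [:: c; b; a].
Proof. by rewrite -(rev_uniq [:: a; b; c]). Qed.

Lemma uniq3_sym a b c : uniq [:: a; b; c] -> uniq [:: b; a; c].
Proof. by move/uniq3_rot/uniq3_rot/uniq3_rev. Qed.

Lemma uniq3_swap a b c : uniq [:: a; b; c] -> uniq [:: a; c; b].
Proof. by move/uniq3_rot/uniq3_rev. Qed.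

Lemma cyc3_rot a b c : uniq [:: a; b; c] -> cyc3 a b c = cyc3 b c a.
Proof.
move=> U; apply: cyc3_eq; rewrite ?cyc3_1 ?cyc3_2 ?cyc3_3 //.
  exact: uniq3_rot.
by move=> u ub uc ua; rewrite cyc3_out.
Qed.

Lemma cyc3_order a b c : uniq [:: a; b; c] -> #[cyc3 a b c] = 3.
Proof.
move=> U; have n1: cyc3 a b c != 1.
  apply/eqP => /permP/(_ a); rewrite perm1 cyc3_1 //.
  by move: U; rewrite uniq3P => /and3P[/eqP ab _ _] ba; case: ab.
apply: nt_prime_order => //; apply/permP=> u.
have E s : (s ^+ 3) u = s (s (s u)) by rewrite !expgS expg0 mulg1 !permM.
rewrite E perm1.
have [->|ua] := eqVneq u a; first by rewrite cyc3_1 ?cyc3_2 ?cyc3_3.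
have [->|ub] := eqVneq u b; first by rewrite cyc3_2 ?cyc3_3 ?cyc3_1.
have [->|uc] := eqVneq u c; first by rewrite cyc3_3 ?cyc3_1 ?cyc3_2.
by rewrite !cyc3_out.
Qed.

(** The classes of this relation are the orbits of the subgroup generated by the
    three-cycles in [G]; a direct definition makes the relation decidable and
    displays the three-cycles that are needed. *)
Definition linked G a b :=
  (a == b) || [exists c, uniq [:: a; b; c] && (cyc3 a b c \in G)].

Lemma linkedP G a b : reflect (a = b \/ exists2 c, uniq [:: a; b; c] & cyc3 a b c \in G)
  (linked G a b).
Proof.
apply: (iffP orP) => -[].
- by move/eqP; left.
- by case/existsP=> c /andP[U h]; right; exists c.
- by move=> ->; left; rewrite eqxx.
by case=> c U h; right; apply/existsP; exists c; rewrite U.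
Qed.

Lemma cyc3_sym_in G a b c : uniq [:: a; b; c] -> cyc3 a b c \in G -> cyc3 b a c \in G.
Proof.
move=> U; rewrite -groupV cyc3V => h.
by rewrite (cyc3_rot (uniq3_sym U)).
Qed.

Lemma linked_refl G : reflexive (linked G).
Proof. by move=> a; apply/linkedP; left. Qed.

Lemma linked_sym G : symmetric (linked G).
Proof.
suff h a b : linked G a b -> linked G b a by move=> a b; apply/idP/idP; apply: h.
case/linkedP=> [->|[c U h]]; first exact: linked_refl.
apply/linkedP; right; exists c; [exact: uniq3_sym | exact: cyc3_sym_in].
Qed.

(** If [a] is carried to [b] by a three-cycle that fixes [d], conjugating by it
    the three-cycle from [b] to [d] gives one from [a] to [d]. *)
Lemma linked_trans G : transitive (linked G).
Proof.
move=> b a d /linkedP[->//|[c U h]] /linkedP[<-|[e V k]].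
  by apply/linkedP; right; exists c.
have [<-|ad] := eqVneq a d; first exact: linked_refl.
apply/linkedP; right.
have [Ecd|cd] := eqVneq c d.
  by exists b; rewrite -Ecd; [exact: uniq3_swap | rewrite -cyc3V groupV].
have [/and3P[ab ac bc] /and3P[bd be de]] := (etrans (esym (uniq3P _ _ _)) U, etrans (esym (uniq3P _ _ _)) V).
have U' := uniq3_swap U.
have cb : cyc3 a c b b = a by rewrite cyc3_3.
have cdE : cyc3 a c b d = d by rewrite cyc3_out // eq_sym.
exists (cyc3 a c b e).
  have := V; rewrite -(map_inj_uniq (@perm_inj _ (cyc3 a c b))) [map _ _]/=.
  by rewrite cb cdE.
have E : cyc3 a d (cyc3 a c b e) = cyc3 b d e ^ cyc3 a c b by rewrite cyc3J cb cdE.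
by rewrite E groupJ // -cyc3V groupV.
Qed.

End ThreeCycles.

(** * Classes of linked points *)

Section Classes.

Variable T : finType.
Implicit Types (a b c d e u v : T) (s t x y : {perm T}) (S D E : {set T}).
Implicit Types G H K : {group {perm T}}.

(** The two three-cycles agree on [u], so that dividing one by the other leaves
    a permutation of the remaining three points. *)
Lemma cyc3_share G u v w z : uniq [:: u; v; w] -> uniq [:: u; v; z] -> w != z ->
  cyc3 u v w \in G -> cyc3 u v z \in G -> cyc3 u w z \in G.
Proof.
move=> U1 U2 wz h1 h2.
have /and3P[uv uw vw] := etrans (esym (uniq3P _ _ _)) U1.
have /and3P[_ uz vz] := etrans (esym (uniq3P _ _ _)) U2.
have zw : z != w by rewrite eq_sym.
have [zu zv] : z != u /\ z != v by split; rewrite eq_sym.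
have [wu wv] : w != u /\ w != v by split; rewrite eq_sym.
have -> : cyc3 u w z = (cyc3 u v w)^-1 * cyc3 u v z; last by rewrite groupM ?groupV.
symmetry; apply: cyc3_eq; first by rewrite uniq3P uw uz.
- by rewrite cyc3V permM cyc3_1 ?(uniq3_swap U1) // cyc3_out.
- by rewrite cyc3V permM cyc3_2 ?(uniq3_swap U1) // cyc3_2.
- by rewrite cyc3V permM (@cyc3_out _ u w v z) ?cyc3_3.
move=> q qu qw qz; have [->|qv] := eqVneq q v.
  by rewrite cyc3V permM cyc3_3 ?(uniq3_swap U1) // cyc3_1.
by rewrite cyc3V permM !cyc3_out.
Qed.

(** Within a class every three-cycle is available: a three-cycle moving [a] to
    [b] and one moving [a] to [c] together generate the alternating group on
    the at most five points that they move. *)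
Lemma linked_cyc3 G a b c : linked G a b -> linked G a c -> uniq [:: a; b; c] ->
  cyc3 a b c \in G.
Proof.
move=> ab ac U; have /and3P[nab nac nbc] := etrans (esym (uniq3P _ _ _)) U.
case/linkedP: ab => [E|[e V h]]; first by rewrite E eqxx in nab.
case/linkedP: ac => [E|[f W k]]; first by rewrite E eqxx in nac.
have [Eec|ec] := eqVneq e c; first by rewrite -Eec.
have [Efb|fb] := eqVneq f b; first by rewrite -groupV cyc3V -Efb.
have /and3P[_ ae be] := etrans (esym (uniq3P _ _ _)) V.
have /and3P[_ af cf] := etrans (esym (uniq3P _ _ _)) W.
have bec : uniq [:: b; e; c] by rewrite uniq3P be nbc ec.
have bea := uniq3_rot V.
have hb : cyc3 b e a \in G by rewrite -cyc3_rot.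
suff hc : cyc3 b e c \in G.
  rewrite (cyc3_rot U); apply: (cyc3_share bec bea _ hc hb).
  by rewrite eq_sym.
have [Eef|ef] := eqVneq e f.
  rewrite -groupV cyc3V (cyc3_rot (uniq3_swap bec)) (cyc3_rot (uniq3_rot (uniq3_swap bec))).
  apply: (@cyc3_share G e a b c) => //.
  - by apply: uniq3_rot; exact: uniq3_rot.
  - by rewrite Eef; apply: uniq3_rot; exact: uniq3_rot.
  - by rewrite (cyc3_rot (uniq3_rot (uniq3_rot V))).
  - by rewrite Eef (cyc3_rot (uniq3_rot (uniq3_rot W))).
have [eb ba] : b != f /\ b != a by split; rewrite eq_sym.
have ea : e != a by rewrite eq_sym.
have := groupJ h k; rewrite cyc3J cyc3_1 // !cyc3_out //.
by rewrite cyc3_rot //; exact: uniq3_rot (uniq3_rot bec).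
Qed.

Definition cls G a := [set b | linked G a b].

Lemma in_cls G a b : (b \in cls G a) = linked G a b.
Proof. by rewrite inE. Qed.

Lemma cls_refl G a : a \in cls G a.
Proof. by rewrite in_cls linked_refl. Qed.

Lemma cls_eq G a b : b \in cls G a -> cls G b = cls G a.
Proof.
rewrite in_cls => ab; apply/setP=> c; rewrite !in_cls.
apply/idP/idP; first exact: linked_trans.
by apply: linked_trans; rewrite linked_sym.
Qed.

Lemma linkedJ G a b s : s \in G -> linked G (s a) (s b) = linked G a b.
Proof.
suff h r u v : r \in G -> linked G u v -> linked G (r u) (r v).
  move=> sG; apply/idP/idP; last exact: h.
  by move/(h s^-1 _ _); rewrite groupV !permK; apply.
move=> rG /linkedP[->|[z U h]]; first exact: linked_refl.
apply/linkedP; right; exists (r z); last by rewrite -cyc3J groupJ.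
by rewrite -(map_inj_uniq (@perm_inj _ r)) in U.
Qed.

Lemma clsJ G a s : s \in G -> cls G (s a) = s @: cls G a.
Proof.
move=> sG; apply/setP=> b; rewrite -[b](permKV s) (mem_imset _ _ (@perm_inj _ s)).
by rewrite !in_cls linkedJ.
Qed.

Lemma cls_cyc3 G a b c : uniq [:: a; b; c] -> cyc3 a b c \in G ->
  [/\ a \in cls G a, b \in cls G a & c \in cls G a].
Proof.
move=> U h; split; first exact: cls_refl.
  by rewrite in_cls; apply/linkedP; right; exists c.
rewrite in_cls; apply/linkedP; right; exists b; first exact: uniq3_swap.
by rewrite -cyc3V groupV.
Qed.

Definition cyc3_free G := forall a b c, uniq [:: a; b; c] -> cyc3 a b c \notin G.

Lemma cls_le2_free G : (forall a, #|cls G a| <= 2) -> cyc3_free G.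
Proof.
move=> le2 a b c U; apply/negP=> h; have [aA bA cA] := cls_cyc3 U h.
have: [set a; b; c] \subset cls G a.
  by rewrite !subUset !sub1set aA bA cA.
move/subset_leq_card/leq_trans/(_ (le2 a)); move: U; rewrite uniq3P => /and3P[ab ac bc].
by rewrite setUC cardsU1 !inE negb_or !(eq_sym c) ac bc cards2 ab.
Qed.

End Classes.

(** * Groups without three-cycles *)

Section Supports.

Variable T : finType.
Implicit Types (a b c d e u v : T) (s t x y : {perm T}) (S D E : {set T}).
Implicit Types G H K : {group {perm T}}.

Lemma SymS D E : D \subset E -> perm.Sym D \subset perm.Sym E.
Proof. by move=> sDE; apply/subsetP=> s; rewrite !inE => /subset_trans; apply. Qed.

Lemma SymI D E : perm.Sym D :&: perm.Sym E = perm.Sym (D :&: E).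
Proof.
apply/setP=> s; rewrite !inE; apply/andP/subsetP => [[/subsetP h1 /subsetP h2] x sx|h].
  by rewrite inE h1 ?h2.
by split; apply/subsetP=> x /h; rewrite inE => /andP[].
Qed.

Lemma Sym_le1 D : #|D| <= 1 -> perm.Sym D = 1.
Proof.
move=> D1; apply/eqP; rewrite eq_sym eqEcard sub1G perm.card_Sym cards1.
by case: #|D| D1 => [|[]].
Qed.

Lemma Sym_fix D s a : s \in perm.Sym D -> a \notin D -> s a = a.
Proof. by rewrite inE; apply: out_perm. Qed.

Lemma Sym_mem D s a : s \in perm.Sym D -> (s a \in D) = (a \in D).
Proof. by rewrite inE; apply: perm_closed. Qed.

(** When the supports of [x] and [y] meet in the single point [a], their
    commutator moves only [a], [x a] and [y a]. *)
Lemma commutator_cyc3 x y a : x a != a -> y a != a ->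
  (forall u, u != a -> x u = u \/ y u = u) ->
  uniq [:: a; y a; x a] /\ [~ x, y] = cyc3 a (y a) (x a).
Proof.
move=> xa ya one.
have fixV (s : {perm T}) u : s u = u -> s^-1 u = u by move=> E; rewrite -{1}E permK.
have mvx u : x u != u -> u != a -> y u = u.
  by move=> xu ua; case: (one u ua) => // E; rewrite E eqxx in xu.
have mvy u : y u != u -> u != a -> x u = u.
  by move=> yu ua; case: (one u ua) => // E; rewrite E eqxx in yu.
have yb : y (x a) = x a by apply: mvx; rewrite // (inj_eq perm_inj).
have xc : x (y a) = y a by apply: mvy; rewrite // (inj_eq perm_inj).
have U : uniq [:: a; y a; x a].
  rewrite uniq3P !(eq_sym a) xa ya /=; apply: contra xa => /eqP E.
  by rewrite -(inj_eq (@perm_inj _ x)) -{1}E xc E.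
split=> //; apply: cyc3_eq => //; rewrite /commg /conjg ?permM.
- have p1 : x (x^-1 a) != x^-1 a.
    by rewrite permKV eq_sym; apply: contra xa => /eqP E; rewrite -{1}E permKV.
  have p2 : x^-1 a != a by move: p1; rewrite permKV eq_sym.
  by rewrite (fixV y _ (mvx _ p1 p2)) permKV.
- by rewrite (fixV x _ xc) permK yb.
- rewrite permK.
  have p1 : y (y^-1 a) != y^-1 a.
    by rewrite permKV eq_sym; apply: contra ya => /eqP E; rewrite -{1}E permKV.
  have p2 : y^-1 a != a by move: p1; rewrite permKV eq_sym.
  by rewrite (mvy _ p1 p2) permKV.
move=> u ua uc ub; rewrite !permM.
have [Ex|xu] := eqVneq (x u) u.
  rewrite (fixV x _ Ex).
  have [Ey|yu] := eqVneq (y u) u; first by rewrite (fixV y _ Ey) Ex Ey.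
  have p2 : y^-1 u != a by apply: contra uc => /eqP E; rewrite -E permKV.
  have p1 : y (y^-1 u) != y^-1 u.
    by rewrite permKV eq_sym; apply: contra yu => /eqP E; rewrite -{1}E permKV.
  by rewrite (mvy _ p1 p2) permKV.
have p2 : x^-1 u != a by apply: contra ub => /eqP E; rewrite -E permKV.
have p1 : x (x^-1 u) != x^-1 u.
  by rewrite permKV eq_sym; apply: contra xu => /eqP E; rewrite -{1}E permKV.
by rewrite (fixV y _ (mvx _ p1 p2)) permKV (mvx _ xu).
Qed.

(** Bochert's argument.  Take a smallest set [B] of points with trivial
    pointwise stabiliser.  If [B] had more than half of the points, neither its
    complement nor [B] minus a point would be such a set, which yields two
    non-trivial elements whose supports meet in one point, hence a three-cycle.
    So [B] has at most half of the points, and the symmetric group on the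
    complement of [B] meets [G] trivially. *)
Lemma cyc3_free_bound G S : G \subset perm.Sym S -> cyc3_free G ->
  #|G| * (uphalf #|S|)`! <= #|S|`!.
Proof.
move=> sGS free.
pose base (B : {set T}) := (B \subset S) && (G :&: perm.Sym (S :\: B) \subset [1]).
have baseS : base S by rewrite /base subxx setDv Sym_le1 ?cards0 // subsetIr.
case: (arg_minnP (fun B : {set T} => #|B|) baseS) => B /andP[sBS trB] minB.
have cardD : #|S :\: B| + #|B| = #|S|.
  by rewrite -(cardsID B S) (setIidPr sBS) addnC.
have nbase (A : {set T}) : A \subset S -> #|A| < #|B| ->
    exists2 s, s \in G :&: perm.Sym (S :\: A) & s != 1.
  move=> sAS ltA; have /subsetPn[s sG]: ~~ (G :&: perm.Sym (S :\: A) \subset [1]).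
    apply/negP=> trA; have := minB A.
    by rewrite /base sAS trA leqNgt ltA => /(_ isT).
  by rewrite inE => s1; exists s.
have leB : #|B| <= #|S|./2.
  rewrite leqNgt; apply/negP=> ltB.
  have [|x] := nbase (S :\: B) (subsetDl _ _).
    by move: ltB cardD; lia.
  rewrite setDDr setDv set0U (setIidPr sBS) => /setIP[xG xB] x1.
  have [a xa] : exists a, x a != a.
    apply/existsP; rewrite -negb_forall; apply: contra x1 => /forallP fx.
    by apply/eqP/permP=> a; rewrite perm1; apply/eqP/fx.
  have aB : a \in B by apply: contraR xa => /(Sym_fix xB) ->.
  have [||y /setIP[yG yD] y1] := nbase (B :\ a).
    exact: subset_trans (subsetDl _ _) sBS.
    by rewrite [X in _ < X](cardsD1 a) aB.
  have yo u : u \in B -> u != a -> y u = u.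
    by move=> uB ua; apply: (Sym_fix yD); rewrite !inE ua uB.
  have ya : y a != a.
    apply/eqP=> ya; case/negP: y1; rewrite -in_set1.
    apply: (subsetP trB); rewrite !inE yG /=; apply/subsetP=> u yu.
    have: u \in S :\: (B :\ a) by move: yu; apply: contraR => /(Sym_fix yD)/eqP.
    rewrite !inE negb_and negbK => /andP[/orP[/eqP ua|->//]].
    by move: yu; rewrite ua inE ya eqxx.
  have one u : u != a -> x u = u \/ y u = u.
    have [uB|uB] := boolP (u \in B) => ua; first by right; apply: yo.
    by left; apply: Sym_fix xB _.
  have [U E] := commutator_cyc3 xa ya one.
  by case/negP: (free _ _ _ U); rewrite -E groupR.
have TI : G :&: perm.Sym (S :\: B) = 1 by apply/eqP; rewrite eqEsubset trB sub1G.
have := subset_leq_card (mul_subG sGS (SymS (subsetDl S B))).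
rewrite (TI_cardMg TI) !perm.card_Sym; apply: leq_trans; rewrite leq_mul2l leq_fact ?orbT //.
by move: cardD leB; lia.
Qed.

End Supports.

Local Open Scope nat_scope.

(** * Divisibility of orders by means of classes *)

Section Stabilisers.

Variable T : finType.
Implicit Types (a b c d e u v : T) (s t x y : {perm T}) (S D E : {set T}).
Implicit Types G H K : {group {perm T}}.

Lemma orbit_setact_cls G a E :
  E \in orbit 'P^* G (cls G a) -> exists2 s, s \in G & E = cls G (s a).
Proof.
by case/orbitP=> s sG <-; exists s => //; rewrite clsJ.
Qed.

Lemma card_set_orbit_stab G D :
  #|orbit 'P^* G D| * #|'N_G(D | 'P)| = #|G|.
Proof. by rewrite -astab1_set card_orbit_stab. Qed.

Lemma cent_SymI G S D : G \subset perm.Sym S ->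
  'C_G(D | 'P) = G :&: perm.Sym (S :\: D).
Proof.
move=> sGS; rewrite -[D in 'C(D | _)]setCK -SymE -[in LHS](setIidPl sGS).
by rewrite -setIA SymI setDE.
Qed.

(** The stabiliser of [D] acts on [D] with the pointwise stabiliser of [D] as
    kernel. *)
Lemma card_set_stab G S D : G \subset perm.Sym S ->
  exists2 m, m %| #|D|`! & #|'N_G(D | 'P)| = m * #|G :&: perm.Sym (S :\: D)|.
Proof.
move=> sGS; exists #|restr_perm D @* 'N_G(D | 'P)|.
  rewrite -perm.card_Sym; apply: cardSg; apply/subsetP=> _ /morphimP[s _ _ ->].
  by rewrite inE restr_perm_on.
rewrite -(cent_SymI D sGS) card_morphim (setIidPr (subsetIr _ _)) ker_restr_perm.
rewrite -[LHS](LagrangeI _ 'C(D | 'P)) mulnC; congr (_ * _).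
by rewrite -setIA (setIidPr (astab_sub _ _)).
Qed.

Lemma set_stab_dvd G S D : G \subset perm.Sym S -> D \subset S ->
  #|'N_G(D | 'P)| %| #|D|`! * (#|S| - #|D|)`!.
Proof.
move=> sGS sDS; have [m dv ->] := card_set_stab D sGS; apply: dvdn_mul => //.
have <- : #|S :\: D| = #|S| - #|D| by rewrite cardsD (setIidPr sDS).
by rewrite -perm.card_Sym; apply/cardSg/subsetIr.
Qed.

(** Translation by an odd element exchanges the even and the odd elements. *)
Lemma card_Alt_half G s : s \in G -> odd_perm s -> #|G :&: 'Alt_T| * 2 = #|G|.
Proof.
move=> sG os; rewrite -(cardsID 'Alt_T G) muln2 -addnn; congr (_ + _).
rewrite -(card_rcoset (G :&: 'Alt_T) s); apply: eq_card => x.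
rewrite mem_rcoset in_setI in_setD groupMr ?groupV // !Alt_even odd_permM odd_permV os.
by rewrite addbT negbK andbC.
Qed.

(** The symmetric group ([c = 1]) and the alternating group ([c = 2]) are treated
    together: [c] is the index in the symmetric group of the group in which
    subgroups are taken, and it enters the divisibility conditions below. *)
Definition within (c : nat) G := (c == 1) || (c == 2) && (G \subset 'Alt_T).

(** The factor 2 for groups of even permutations comes from a transposition of
    two points of [D], which lies in the full stabiliser of [D]. *)
Lemma within_stab_dvd (c : nat) G S D : within c G -> G \subset perm.Sym S ->
  D \subset S -> 1 < #|D| -> c * #|'N_G(D | 'P)| %| #|D|`! * (#|S| - #|D|)`!.
Proof.
move=> /orP[/eqP->|/andP[/eqP-> sGA]] sGS sDS D1.
  by rewrite mul1n; apply: set_stab_dvd.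
case/card_gt1P: D1 => a [b [aD bD ab]].
have tS : tperm a b \in 'N_(perm.Sym S)(D | 'P).
  rewrite inE; apply/andP; split.
    rewrite inE; apply: subset_trans (tperm_on a b) _.
    by rewrite subUset !sub1set !(subsetP sDS).
  apply/astabsP=> u; rewrite /= apermE; case: tpermP => [->|->|//]; by rewrite aD bD.
apply: dvdn_trans (set_stab_dvd (subxx (perm.Sym_group S)) sDS).
rewrite -(card_Alt_half tS); last by rewrite odd_tperm.
rewrite mulnC dvdn_pmul2r //; apply: cardSg.
by rewrite subsetI setSI // subIset // sGA.
Qed.

(** The three-cycles on [D] generate the alternating group on [D].  For the order
    it suffices that they act transitively on [D] and that the stabiliser of a
    point contains those on the remaining points. *)
Lemma Alt_cls_dvd G a D : D \subset cls G a -> #|D|`! %| 2 * #|G :&: perm.Sym D|.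
Proof.
have [m] := ubnP #|D|; elim: m D => // m IH D /ltnSE leDm sDA.
have [le2|gt2] := leqP #|D| 2; first by case: #|D| le2 => [|[|[]]] //; rewrite dvdn_mulr.
case/card_gt2P: gt2 => b [c [d [[bD cD dD] [bc cd db]]]].
pose K := (G :&: perm.Sym D)%G.
have oK : orbit 'P K b = D.
  apply/setP=> u; apply/orbitP/idP => [[s /setIP[_ sD] <-]|uD].
    by rewrite /= apermE (Sym_mem _ sD).
  have [->|ub] := eqVneq u b; first by exists 1%g; rewrite ?act1.
  have [v vD vU] : exists2 v, v \in D & uniq [:: b; u; v].
    have [Euc|uc] := eqVneq u c.
      by exists d => //; rewrite uniq3P Euc bc cd eq_sym db.
    by exists c => //; rewrite uniq3P bc uc eq_sym ub.
  exists (cyc3 b u v); last by rewrite /= apermE cyc3_1.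
  have Eb := cls_eq (subsetP sDA b bD).
  rewrite inE; apply/andP; split.
    by apply: linked_cyc3; rewrite // -in_cls Eb (subsetP sDA).
  rewrite inE; apply/subsetP=> w; apply: contraR => wD.
  by rewrite cyc3_out //; apply: contra wD => /eqP->.
have stab : 'C_K[b | 'P] = G :&: perm.Sym (D :\ b).
  rewrite -setIA; congr (_ :&: _); apply/setP=> s.
  rewrite inE; apply/andP/idP=> [[sD /astab1P /=]|sb].
    rewrite apermE => sb; rewrite inE; apply/subsetP=> u su.
    have: u \in D by move: su; apply: contraR => /(Sym_fix sD) /eqP.
    by rewrite !inE => ->; rewrite andbT; apply: contra su => /eqP->; rewrite sb.
  split; first exact: subsetP (SymS (subsetDl _ _)) _ sb.
  by apply/astab1P; rewrite /= apermE (Sym_fix sb) // !inE eqxx.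
have := card_orbit_stab 'P K b; rewrite oK stab => <-.
have cD1 : #|D| = #|D :\ b|.+1 by rewrite (cardsD1 b) bD.
rewrite mulnCA cD1 factS dvdn_pmul2l //; apply: IH; first by rewrite -cD1.
exact: subset_trans (subsetDl _ _) sDA.
Qed.

(** A group without three-cycles cannot contain a Sylow 3-subgroup of the
    symmetric group, for such a subgroup meets the class of three-cycles. *)
Lemma cyc3_free_dvd3 G S : G \subset perm.Sym S -> cyc3_free G -> 2 < #|S| ->
  3 * #|G| %| #|S|`!.
Proof.
move=> sGS free /card_gt2P[a [b [c [[aS bS cS] [ab bc ca]]]]].
have U : uniq [:: a; b; c] by rewrite uniq3P ab bc eq_sym ca.
have xS : cyc3 a b c \in perm.Sym S.
  rewrite inE; apply/subsetP=> w; apply: contraR => wD.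
  by rewrite cyc3_out //; apply: contra wD => /eqP->.
have [|] := boolP (3 %| #|perm.Sym S : G|).
  by rewrite -perm.card_Sym -(Lagrange sGS) mulnC => ?; rewrite dvdn_pmul2l.
move=> n3; have [P sylP] := Sylow_exists 3 G.
have sylS : 3.-Sylow(perm.Sym S) P.
  rewrite /pHall (subset_trans (pHall_sub sylP) sGS) (pHall_pgroup sylP) /=.
  rewrite -(Lagrange_index sGS (pHall_sub sylP)) pnatM.
  case/and3P: sylP => _ _ ->; rewrite andbT /=.
  by rewrite p'natE.
have p3 : 3.-group <[cyc3 a b c]> by rewrite /pgroup -orderE cyc3_order.
have [|s sS sub] := Sylow_Jsub sylS _ p3; first by rewrite cycle_subG.
have U' : uniq [:: s a; s b; s c] by rewrite -(map_inj_uniq (@perm_inj _ s)) in U.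
case/negP: (free _ _ _ U').
rewrite -cyc3J (subsetP (pHall_sub sylP)) // (subsetP sub) //.
by rewrite memJ_conjg cycle_id.
Qed.

End Stabilisers.

(** * Stripping off classes *)

Section ClassSizes.

Variable T : finType.
Implicit Types (a b : T) (s t x y : {perm T}) (S D E : {set T}).
Implicit Types G H K : {group {perm T}}.

Lemma cls_sub G S a : G \subset perm.Sym S -> a \in S -> cls G a \subset S.
Proof.
move=> sGS aS; apply/subsetP=> b; rewrite in_cls => /linkedP[<-//|[c U h]].
have := subsetP sGS _ h; rewrite inE => /subsetP; apply.
rewrite inE cyc3_2 //; move: U; rewrite uniq3P eq_sym => /and3P[_ _].
by rewrite eq_sym.
Qed.

Lemma cls_out G S a : G \subset perm.Sym S -> a \notin S -> #|cls G a| = 1.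
Proof.
move=> sGS aS; rewrite (_ : cls G a = [set a]) ?cards1 //; apply/setP=> b.
rewrite !inE; apply/linkedP/eqP => [[->//|[c U h]]|->]; last by left.
case/negP: aS; have := subsetP sGS _ h; rewrite inE => /subsetP; apply.
by rewrite inE cyc3_1 //; move: U; rewrite uniq3P eq_sym => /and3P[].
Qed.

Definition classes_of_size G S (e : nat) := [set cls G a | a in S & #|cls G a| == e].

Lemma classes_of_sizeP G S e D :
  reflect (exists2 a, a \in S & D = cls G a /\ #|D| = e) (D \in classes_of_size G S e).
Proof.
apply: (iffP imsetP) => [[a /[!inE] /andP[aS /eqP sz] ->]|[a aS [-> sz]]]; exists a => //.
by rewrite inE aS sz eqxx.
Qed.

Arguments classes_of_sizeP {G S e D}.

Lemma classes_disjoint G S e D E u : D \in classes_of_size G S e ->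
  E \in classes_of_size G S e -> u \in D -> u \in E -> D = E.
Proof.
case/classes_of_sizeP=> a _ [-> _] /classes_of_sizeP[b _ [-> _]].
by move=> /cls_eq <- /cls_eq <-.
Qed.

Lemma card_classes_of_size G S e : G \subset perm.Sym S ->
  #|classes_of_size G S e| * e <= #|S|.
Proof.
move=> sGS; have tI : trivIset (classes_of_size G S e).
  apply/trivIsetP=> D E hD hE; apply: contraR => /pred0Pn[u /andP[/= uD uE]].
  by rewrite (classes_disjoint hD hE uD uE).
have <- : #|cover (classes_of_size G S e)| = #|classes_of_size G S e| * e.
  rewrite -(eqP tI) -sum_nat_const; apply: eq_bigr => D.
  by case/classes_of_sizeP=> a _ [].
apply: subset_leq_card; apply/bigcupsP=> D /classes_of_sizeP[a aS [-> _]].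
exact: cls_sub.
Qed.

Lemma orbit_classes G S a : G \subset perm.Sym S -> a \in S ->
  orbit 'P^* G (cls G a) \subset classes_of_size G S #|cls G a|.
Proof.
move=> sGS aS; apply/subsetP=> E /orbit_setact_cls[s sG ->].
apply/classes_of_sizeP; exists (s a); first by rewrite (Sym_mem _ (subsetP sGS _ sG)).
by rewrite clsJ // card_imset //; apply: perm_inj.
Qed.

Definition away G S D : {group {perm T}} := (G :&: perm.Sym (S :\: D))%G.

Lemma away_sub G S D : away G S D \subset perm.Sym (S :\: D).
Proof. exact: subsetIr. Qed.

(** Removing a class does not affect the other classes: a three-cycle that
    meets another class is supported in it. *)
Lemma cls_away G S a b : G \subset perm.Sym S -> b \in S :\: cls G a ->
  cls (away G S (cls G a)) b = cls G b.
Proof.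
move=> sGS /setDP[bS ba]; apply/setP=> u; rewrite !in_cls.
apply/linkedP/linkedP => -[->|[v U h]]; try by left.
  by right; exists v => //; case/setIP: h.
right; exists v => //; rewrite inE h inE; apply/subsetP=> w.
have [bB uB vB] := cls_cyc3 U h; have sB := cls_sub sGS bS.
have nA z : z \in cls G b -> z \in S :\: cls G a.
  move=> zB; rewrite inE (subsetP sB) // andbT; apply: contra ba => za.
  by rewrite -(cls_eq za) (cls_eq zB) cls_refl.
apply: contraR => wD; rewrite cyc3_out //; apply: contra wD => /eqP->; exact: nA.
Qed.

(** The class has at most as many conjugates as there are classes of its size,
    and its stabiliser acts on it as a group of permutations. *)
Lemma card_away G S a : G \subset perm.Sym S -> a \in S ->
  #|G| <= #|classes_of_size G S #|cls G a| | * #|cls G a|`! * #|away G S (cls G a)|.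
Proof.
move=> sGS aS; rewrite -(card_set_orbit_stab G (cls G a)) -mulnA leq_mul //.
  exact/subset_leq_card/orbit_classes.
have [m dv ->] := card_set_stab (cls G a) sGS.
by rewrite leq_mul2r dvdn_leq ?fact_gt0 ?orbT.
Qed.

Lemma classes_away G S a e : G \subset perm.Sym S -> a \in S -> #|cls G a| = e ->
  classes_of_size (away G S (cls G a)) (S :\: cls G a) e =
  classes_of_size G S e :\ cls G a.
Proof.
move=> sGS aS sz; apply/setP=> D; rewrite !inE.
apply/classes_of_sizeP/andP => [[b bS [-> szb]]|[Da /classes_of_sizeP[b bS [ED szb]]]].
  rewrite cls_away // in szb *; split.
    apply: contraL bS => /eqP <-; by rewrite inE cls_refl.
  by apply/classes_of_sizeP; exists b => //; case/setDP: bS.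
have bS' : b \in S :\: cls G a.
  by rewrite inE bS andbT; apply: contra Da => /cls_eq <-; rewrite ED.
by exists b; rewrite ?cls_away.
Qed.

(** When [t] classes of size [e] are present, the first of them has at most [t]
    conjugates, the second one at most [t - 1] in what remains, and so on: this
    gives the factor [t`!]. *)
Lemma strip_classes e G S : G \subset perm.Sym S -> exists (K : {group {perm T}}) S',
  [/\ K \subset perm.Sym S', S' \subset S, #|S'| + #|classes_of_size G S e| * e = #|S|,
      #|G| <= e`! ^ #|classes_of_size G S e| * #|classes_of_size G S e|`! * #|K|
    & forall b, b \in S' -> cls K b = cls G b /\ #|cls G b| != e].
Proof.
have [n] := ubnP #|classes_of_size G S e|; elim: n G S => // n IH G S /ltnSE len sGS.
have [E0|[D DP]] := set_0Vmem (classes_of_size G S e).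
  exists G, S; rewrite E0 cards0 mul0n addn0 expn0 fact0 !mul1n.
  split=> // b bS; split=> //; apply/negP=> /eqP sz.
  suff: cls G b \in set0 by rewrite inE.
  by rewrite -E0; apply/classes_of_sizeP; exists b.
have [a aS [ED sz]] := classes_of_sizeP DP; rewrite {}ED in DP sz.
have cP : #|classes_of_size G S e| = #|classes_of_size G S e :\ cls G a|.+1.
  by rewrite (cardsD1 (cls G a)) DP.
have [||K [S' [sK sSS sS' leK cK]]] := IH (away G S (cls G a)) (S :\: cls G a).
- by rewrite classes_away // -ltnS -cP.
- exact: away_sub.
rewrite classes_away // in sS' leK; exists K, S'.
set t := #|_ :\ _| in cP sS' leK *.
have sS : #|S| = #|S :\: cls G a| + e.
  by rewrite -(cardsID (cls G a) S) (setIidPr (cls_sub sGS aS)) sz addnC.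
split=> //.
- exact: subset_trans sSS (subsetDl _ _).
- by rewrite cP mulSn sS -sS' addnCA addnC.
- have := card_away sGS aS; rewrite sz cP => /leq_trans; apply.
  rewrite expnS factS -!mulnA.
  rewrite (_ : e`! * (e`! ^ t * (t.+1 * (t`! * #|K|))) = t.+1 * (e`! * (e`! ^ t * t`! * #|K|))); last by lia.
  by rewrite !leq_mul2l leK !orbT.
move=> b bS'; have [Ec ne] := cK b bS'.
by rewrite Ec (cls_away sGS) ?(subsetP sSS) // in ne *.
Qed.

End ClassSizes.

(** * Order bounds that can be evaluated *)

Fixpoint factN (k : nat) : N :=
  if k is k'.+1 then (N.of_nat k * factN k')%num else 1%num.

Definition maxN (s : seq N) : N := foldr N.max 0%num s.

(** The bound of [strip_classes], iterated: [cap d m] is for groups on [m] points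
    all of whose classes have at most [d] points, and the maximum is over the
    number [t] of classes of size [d].  Below [d = 3] there are no three-cycles
    and Bochert's bound takes over. *)
Fixpoint cap (d m : nat) : N :=
  if d is d'.+1 then
    if d' < 2 then cap d' m else
    maxN [seq (factN d ^ N.of_nat t * factN t * cap d' (m - t * d))%num
         | t <- iota 0 (m %/ d).+1]
  else (factN m / factN (uphalf m))%num.

(** The bound in the presence of exactly [t] classes of the largest size [e]. *)
Definition stripcap (e t m : nat) : N :=
  (factN e ^ N.of_nat t * factN t * cap e.-1 (m - t * e))%num.

Lemma factN_nat k : N.to_nat (factN k) = k`!.
Proof.
elim: k => // k IH; rewrite factS -IH -[factN k.+1]/(N.of_nat k.+1 * factN k)%num.
by rewrite Nnat.N2Nat.inj_mul Nnat.Nat2N.id.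
Qed.

Lemma factN_pow k t : N.to_nat (factN k ^ N.of_nat t) = k`! ^ t.
Proof.
elim: t => // t IH; rewrite Nnat.Nat2N.inj_succ N.pow_succ_r'.
by rewrite expnS -IH -factN_nat Nnat.N2Nat.inj_mul.
Qed.

Lemma maxN_ge s x : x \in s -> N.to_nat x <= N.to_nat (maxN s).
Proof.
elim: s => //= y s IH; rewrite inE => /orP[/eqP->|/IH]; lia.
Qed.

Lemma N_leq x y : N.to_nat x <= N.to_nat y -> (x <= y)%num.
Proof. lia. Qed.

Section Trichotomy.

Variable T : finType.
Implicit Types (a b : T) (s t x y : {perm T}) (S D E : {set T}).
Implicit Types G H K : {group {perm T}}.

Lemma bochert_quotient G S : G \subset perm.Sym S -> cyc3_free G ->
  #|G| <= N.to_nat (factN #|S| / factN (uphalf #|S|)).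
Proof.
move=> sGS /(cyc3_free_bound sGS) le.
suff: (N.of_nat #|G| <= factN #|S| / factN (uphalf #|S|))%num by lia.
apply: N.div_le_lower_bound.
  by have := fact_gt0 (uphalf #|S|); rewrite -factN_nat; lia.
by move: le; rewrite -!factN_nat; nia.
Qed.

Lemma stripcap_bound e G S : G \subset perm.Sym S -> (forall a, #|cls G a| <= e) ->
  (forall K S', K \subset perm.Sym S' -> (forall a, #|cls K a| <= e.-1) ->
     #|K| <= N.to_nat (cap e.-1 #|S'|)) -> 1 < e ->
  #|G| <= N.to_nat (stripcap e #|classes_of_size G S e| #|S|).
Proof.
move=> sGS le IH e1; have [K [S' [sK sS' cS leG cK]]] := strip_classes e sGS.
have leK : #|K| <= N.to_nat (cap e.-1 #|S'|).
  apply: IH => // a; have [aS'|aS'] := boolP (a \in S').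
    have [-> ne] := cK a aS'; have := le a; move: ne; lia.
  by rewrite (cls_out sK aS'); lia.
rewrite /stripcap (_ : #|S| - _ = #|S'|); last by rewrite -cS addnK.
rewrite !Nnat.N2Nat.inj_mul factN_pow factN_nat.
exact: leq_trans leG (leq_mul (leqnn _) leK).
Qed.

Lemma cap_bound d G S : G \subset perm.Sym S -> (forall a, #|cls G a| <= d) ->
  #|G| <= N.to_nat (cap d #|S|).
Proof.
elim: d G S => [|d IH] G S sGS le.
  apply: (bochert_quotient sGS); apply: cls_le2_free => a.
  exact: leq_trans (le a) _.
have [d2|d2] := ltnP d 2.
  have -> : cap d.+1 #|S| = (factN #|S| / factN (uphalf #|S|))%num by case: d d2 {IH le} => [|[]].
  apply: (bochert_quotient sGS); apply: cls_le2_free => a.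
  exact: leq_trans (le a) _.
have -> : cap d.+1 #|S| =
    maxN [seq stripcap d.+1 i #|S| | i <- iota 0 (#|S| %/ d.+1).+1].
  by rewrite [LHS]/= ltnNge d2.
have ld : 1 < d.+1 by lia.
have sle := stripcap_bound sGS le IH ld.
apply: leq_trans sle (maxN_ge _); apply/mapP.
exists #|classes_of_size G S d.+1| => //; rewrite mem_iota add0n ltnS.
by rewrite leq_divRL // card_classes_of_size.
Qed.

Lemma cardS_Sym G : G \subset perm.Sym [set: T].
Proof. by apply/subsetP=> s _; rewrite inE; apply/subsetP. Qed.

(** The alternating groups of two disjoint classes commute and intersect
    trivially. *)
Lemma two_classes_dvd G S e : #|classes_of_size G S e| = 2 -> e`! ^ 2 %| 4 * #|G|.
Proof.
move=> c2; have [D [E [hD hE DE]]] : exists D E,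
    [/\ D \in classes_of_size G S e, E \in classes_of_size G S e & D != E].
  have /card_gt1P[D [E [? ? ?]]] : 1 < #|classes_of_size G S e| by rewrite c2.
  by exists D, E.
have dis : [disjoint D & E].
  apply/pred0P=> u /=; apply/negP=> /andP[uD uE].
  by rewrite (classes_disjoint hD hE uD uE) eqxx in DE.
pose A := (G :&: perm.Sym D)%G; pose B := (G :&: perm.Sym E)%G.
have cAB : B \subset 'C(A).
  apply/centsP=> x /setIP[_ xE] y /setIP[_ yD]; rewrite !inE in xE yD.
  by apply: (perm_onC (S1 := E) (S2 := D)); rewrite // disjoint_sym.
have tAB : A :&: B = 1%g.
  apply/trivgP; rewrite -(@Sym_le1 _ set0) ?cards0 //.
  move: dis; rewrite -setI_eq0 => /eqP <-; rewrite -SymI.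
  by rewrite setISS ?subsetIr.
have dv : #|A| * #|B| %| #|G|.
  rewrite -(TI_cardMg tAB) -cent_joinEr //; apply: cardSg.
  by rewrite join_subG !subsetIl.
have cl F : F \in classes_of_size G S e -> e`! %| 2 * #|G :&: perm.Sym F|.
  by case/classes_of_sizeP=> a _ [EF <-]; apply: (@Alt_cls_dvd _ _ a); rewrite EF.
apply: dvdn_trans (_ : (2 * #|A|) * (2 * #|B|) %| _).
  by rewrite -mulnn dvdn_mul // cl.
by rewrite mulnACA dvdn_pmul2l.
Qed.

(** Apart from groups without three-cycles, a class of maximal size is either so
    large that it is unique, hence stabilised, or of size at most half the
    number of points, and then it has few conjugates. *)
Lemma class_trichotomy (c : nat) G : within c G ->
  [\/ cyc3_free G,
      exists k, [/\ #|T| < k * 2, 2 < k, k <= #|T|,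
        k`! %| 2 * #|G| & c * #|G| %| k`! * (#|T| - k)`!]
    | exists e m j, [/\ [/\ 2 < e, e * 2 <= #|T|, 0 < j <= m & m * e <= #|T|],
        c * #|G| %| j * (e`! * (#|T| - e)`!),
        #|G| <= N.to_nat (stripcap e m #|T|),
        e * 2 = #|T| -> m = 2 -> e`! ^ 2 %| 4 * #|G|
      & exists2 a, #|cls G a| = e & forall b, #|cls G b| <= e]].
Proof.
move=> cG; have [/forallP le2|/forallPn[a0]] := boolP [forall a, #|cls G a| <= 2].
  by constructor 1; apply: cls_le2_free.
rewrite -ltnNge => gt2; have sGT := cardS_Sym G.
have [a _ maxa] := @arg_maxnP _ a0 xpredT (fun a => #|cls G a|) isT.
have {maxa} le b : #|cls G b| <= #|cls G a| by apply: maxa.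
have {gt2} e2 : 2 < #|cls G a| := leq_trans gt2 (le a0).
pose m := #|classes_of_size G [set: T] (#|cls G a|)|.
have nT : #|[set: T]| = #|T| by rewrite cardsT.
have me : m * #|cls G a| <= #|T| by rewrite -nT; apply: card_classes_of_size.
have en : #|cls G a| <= #|T| by rewrite -nT subset_leq_card ?subsetT.
have jm : 0 < #|orbit 'P^* G (cls G a)| <= m.
  rewrite (subset_leq_card (orbit_classes sGT (in_setT a))) andbT.
  by apply/card_gt0P; exists (cls G a); apply: orbit_refl.
have dvN : c * #|'N_G(cls G a | 'P)| %| #|cls G a|`! * (#|T| - #|cls G a|)`!.
  by rewrite -nT; apply: within_stab_dvd; rewrite ?subsetT // (ltn_trans _ e2).
have dvG : c * #|G| %| #|orbit 'P^* G (cls G a)| * (#|cls G a|`! * (#|T| - #|cls G a|)`!).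
  by rewrite -[#|G|](card_set_orbit_stab G (cls G a)) mulnCA dvdn_pmul2l //; case/andP: jm.
have [lt|ge] := ltnP #|T| (#|cls G a| * 2).
  constructor 2; exists #|cls G a|; split=> //.
    apply: dvdn_trans (Alt_cls_dvd (subxx (cls G a))) _.
    by rewrite dvdn_pmul2l //; apply/cardSg/subsetIl.
  have j1 : #|orbit 'P^* G (cls G a)| = 1 by move: lt me jm e2; nia.
  by rewrite j1 mul1n in dvG.
constructor 3; exists #|cls G a|, m, #|orbit 'P^* G (cls G a)|; split=> //.
  rewrite -nT; apply: stripcap_bound => //; last exact: ltn_trans e2.
  by move=> K S' sK leK; apply: cap_bound.
  by move=> _ m2; apply: two_classes_dvd m2.
by exists a.
Qed.

End Trichotomy.

(** * Elements of large prime order *)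

Section LongCycles.

Variable T : finType.
Implicit Types (a b u v w : T) (s t x y : {perm T}) (S D E : {set T}).
Implicit Types G H K : {group {perm T}}.

Lemma orbit_cycle_fix y w : (orbit 'P <[y]> w == [set w]) = (y w == w).
Proof.
apply/eqP/eqP => [E|yw].
  by apply/set1P; rewrite -E; apply/orbitP; exists y; rewrite ?cycle_id.
by apply/orbit1P; rewrite afix_cycle; apply/afix1P; rewrite /= apermE.
Qed.

(** An element of prime order [p] acts on an invariant set of less than [2p]
    points as a [p]-cycle or trivially. *)
Lemma prime_order_orbit p y D b : prime p -> #[y] = p -> y \in 'N(D | 'P) ->
  #|D| < 2 * p -> b \in D -> y b != b ->
  [set w in D | y w != w] = orbit 'P <[y]> b /\ #|orbit 'P <[y]> b| = p.
Proof.
move=> pp oy nD ltD bD yb.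
have moved w : y w != w -> #|orbit 'P <[y]> w| = p.
  move=> yw; have E := card_orbit 'P <[y]> w.
  have : #|orbit 'P <[y]> w| %| p by rewrite E -oy dvdn_indexg.
  case/primeP: pp => _ pp /pp /orP[/cards1P[u Eu]|/eqP //].
  have : w \in [set u] by rewrite -Eu orbit_refl.
  by move/set1P=> wu; rewrite -orbit_cycle_fix Eu wu eqxx in yw.
have acts : [acts <[y]>, on D | 'P] by rewrite cycle_subG.
have sub w : w \in D -> orbit 'P <[y]> w \subset D by rewrite (acts_sub_orbit _ acts).
split; last exact: moved.
apply/setP=> w; rewrite inE; apply/andP/idP => [[wD yw]|wO]; last first.
  split; first exact: subsetP (sub b bD) _ wO.
  move/orbit_eqP: wO => wO; rewrite -orbit_cycle_fix wO.
  apply/negP=> /eqP E; move: (moved b yb); rewrite E cards1 => p1.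
  by rewrite -p1 in pp.
apply: contraLR ltD => wO; rewrite -leqNgt mul2n -addnn.
rewrite -{1}(moved b yb) -(moved w yw) -cardsUI (_ : _ :&: _ = set0) ?cards0 ?addn0.
  by rewrite subset_leq_card // subUset !sub.
apply/setP=> u; rewrite !inE; apply/negP=> /andP[ub uw]; case/negP: wO.
by move/orbit_eqP: ub => <-; rewrite orbit_sym.
Qed.

(** If every conjugate of [x] that moves [w] also moved [z], then the sets of
    points moved by the same conjugates would form a system of blocks of a
    common size larger than 1.  The size divides [#|D|] and, as the points moved
    by [x] form a union of blocks, also [p]; but [p] does not divide [#|D|]. *)
Lemma conj_separates p G D x w z : prime p -> x \in G -> #[x] = p ->
  {in D, forall a, orbit 'P G a = D} -> p < #|D| < 2 * p ->
  (exists2 b, b \in D & x b != b) -> w \in D -> z \in D -> w != z ->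
  exists y, [/\ y \in G, #[y] = p, y w != w & y z = z].
Proof.
move=> pp xG ox orbD /andP[ltp lt2p] [b bD xb] wD zD wz.
have actsD : G \subset 'N(D | 'P).
  by rewrite -(orbD b bD); apply: acts_orbit; apply: subsetT.
pose C := x ^: G; pose mv u := [set y in C | y u != u].
have CG y : y \in C -> y \in G /\ #[y] = p.
  by case/imsetP=> g gG ->; rewrite groupJ // orderJ.
have mvJ g u : g \in G -> mv (g u) = mv u :^ g.
  move=> gG; apply/setP=> y; rewrite mem_conjg !inE.
  have CJ : C :^ g = C by exact: classGidr.
  rewrite -[in LHS]CJ mem_conjg; congr (_ && _).
  rewrite conjgE invgK !permM -[in LHS](inj_eq (@perm_inj _ g^-1)).
  by rewrite permK.
pose A u := [set u' in D | mv u == mv u'].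
have AJ g u : g \in G -> #|A (g u)| = #|A u|.
  move=> gG; rewrite -(card_imset (A u) (@perm_inj _ g)); apply: eq_card => v.
  rewrite -(permKV g v); move: (g^-1 v)%g => {}v.
  rewrite (mem_imset _ _ (@perm_inj _ g)) !inE !mvJ //.
  have -> : (mv u :^ g == mv v :^ g)%g = (mv u == mv v).
    exact: (inj_eq (@conjsg_inj _ g)).
  have /astabsP/(_ v) := subsetP actsD g gG.
  by rewrite /= apermE => ->.
have trans u : u \in D -> exists2 g, g \in G & u = g w.
  by rewrite -(orbD w wD) => /orbitP[g gG <-]; exists g.
have uniA u : u \in D -> #|A u| = #|A w| by case/trans=> g gG ->; apply: AJ.
have [/existsP[y /and4P[yC yw]]|] := boolP [exists y, [&& y \in C, y w != w, y z == z & true]].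
  move=> /eqP yz _; have [? ?] := CG y yC; by exists y.
rewrite negb_exists => /forallP sep.
have mvwz : mv w = mv z.
  apply/eqP; rewrite eqEcard; apply/andP; split.
    apply/subsetP=> y; rewrite !inE => /andP[yC yw]; rewrite yC /=.
    by have := sep y; rewrite yC yw andbT /=.
  by have [g gG ->] := trans z zD; rewrite mvJ // cardJg.
have A2 : 1 < #|A w|.
  by apply/card_gt1P; exists w, z; rewrite !inE wD zD mvwz eqxx.
have [Eo po] := prime_order_orbit pp ox (subsetP actsD x xG) lt2p bD xb.
have cD : #|D| = #|preim_partition mv D| * #|A w|.
  apply: (card_uniform_partition _ (preim_partitionP mv D)) => B /imsetP[u uD ->].
  exact: uniA.
have xC : x \in C by rewrite class_refl.
have cG : p = #|preim_partition mv [set u in D | x u != u]| * #|A w|.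
  rewrite -{1}po -Eo.
  apply: (card_uniform_partition _ (preim_partitionP mv _)) => B /imsetP[u].
  rewrite inE => /andP[uD xu] ->; rewrite -(uniA u uD); apply: eq_card => v.
  rewrite !inE; case: (mv u =P mv v) => [E|]; rewrite ?andbF // !andbT.
  suff -> : x v != v by rewrite andbT.
  have : x \in mv v by rewrite -E inE xC.
  by rewrite inE xC.
have /primeP[_ /(_ #|A w|)] := pp; rewrite {1}cG dvdn_mull // => /(_ isT) /orP[/eqP E|/eqP E].
  by rewrite E in A2.
have : p %| #|D| by rewrite cD E dvdn_mull.
case/dvdnP=> q Eq; move: ltp lt2p; rewrite Eq -{1}(mul1n p) !ltn_pmul2r ?prime_gt0 //; lia.
Qed.

(** The quotient [#|D|`! / (p.-1)`!] is the product of the numbers from [p] to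
    [#|D|], the orbit lengths of the successive point stabilisers: these stay
    transitive on the remaining points as long as the cycle fixes a point.  A
    conjugate of the cycle that fixes [a] and moves [u] meets the cycle itself,
    as there are less than [2p] points, which links [u] to the cycle in the
    stabiliser of [a]. *)
Lemma long_cycle_falling p G D : prime p ->
  {in D, forall a, orbit 'P G a = D} -> #|D| < 2 * p ->
  (exists x b, [/\ x \in G, #[x] = p, b \in D & x b != b]) ->
  #|D|`! %| (p.-1)`! * #|G|.
Proof.
move=> pp; have [n] := ubnP #|D|; elim: n D G => // n IH D G /ltnSE leDn orbD lt2p.
case=> x [b [xG ox bD xb]].
have actsD : G \subset 'N(D | 'P).
  by rewrite -(orbD b bD); apply: acts_orbit; apply: subsetT.
have [Eo po] := prime_order_orbit pp ox (subsetP actsD x xG) lt2p bD xb.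
have leD : p <= #|D|.
  by rewrite -{1}po -Eo subset_leq_card //; apply/subsetP=> u; rewrite inE => /andP[].
have [Ep|np] := eqVneq #|D| p.
  rewrite Ep -{1}(prednK (prime_gt0 pp)) factS prednK ?prime_gt0 // mulnC.
  by rewrite dvdn_pmul2l ?fact_gt0 // -ox order_dvdG.
have ltp : p < #|D| by rewrite ltn_neqAle eq_sym np.
have [a aD xa] : exists2 a, a \in D & x a = a.
  have : ~~ (D \subset [set u in D | x u != u]).
    by apply: contraL ltp => /subset_leq_card; rewrite Eo po -leqNgt.
  by case/subsetPn=> a aD; rewrite inE aD negbK => /eqP; exists a.
have cD : #|D| = (#|D :\ a|).+1 by rewrite (cardsD1 a) aD.
have bDa : b \in D :\ a by rewrite !inE bD andbT; apply: contra xb => /eqP->; rewrite xa.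
pose K := 'C_G[a | 'P]%G.
have KP y : (y \in K) = (y \in G) && (y a == a).
  by rewrite inE; congr (_ && _); apply/astab1P/eqP; rewrite /= apermE.
have actsK : K \subset 'N(D :\ a | 'P).
  apply/subsetP=> y; rewrite KP => /andP[yG /eqP ya]; apply/astabsP=> u.
  have /astabsP/(_ u) := subsetP actsD y yG; rewrite /= !apermE !inE => ->.
  by have -> : (y u == a) = (u == a) by rewrite -{1}ya (inj_eq perm_inj).
have lt2p' : #|D :\ a| < 2 * p by apply: leq_ltn_trans lt2p; rewrite cD.
have orbK u : u \in D :\ a -> u \in orbit 'P K b.
  rewrite !inE => /andP[ua uD].
  have rng : p < #|D| < 2 * p by rewrite ltp.
  have mvb : exists2 v, v \in D & x v != v by exists b.
  have [y [yG oy yu ya]] := conj_separates pp xG ox orbD rng mvb uD aD ua.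
  have yK : y \in K by rewrite KP yG ya eqxx.
  have xK : x \in K by rewrite KP xG xa eqxx.
  have uDa : u \in D :\ a by rewrite !inE ua.
  have [_ c1] := prime_order_orbit pp ox (subsetP actsK x xK) lt2p' bDa xb.
  have [_ c2] := prime_order_orbit pp oy (subsetP actsK y yK) lt2p' uDa yu.
  have [v vb vu] : exists2 v, v \in orbit 'P <[x]> b & v \in orbit 'P <[y]> u.
    apply/exists_inP; rewrite -[X in is_true X]negbK negb_exists_in.
    apply/negP=> /forall_inP dis; move: lt2p'; rewrite ltnNge => /negP; apply.
    rewrite mul2n -addnn -{1}c1 -c2 -cardsUI (_ : _ :&: _ = set0) ?cards0 ?addn0.
      have sub z w : z \in K -> w \in D :\ a -> orbit 'P <[z]> w \subset D :\ a.
        move=> zK wD; rewrite acts_sub_orbit // cycle_subG; exact: subsetP actsK z zK.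
      by rewrite subset_leq_card // subUset !sub.
    by apply/setP=> v; rewrite !inE; apply/negP=> /andP[/dis/negP].
  have sub z w : z \in K -> orbit 'P <[z]> w \subset orbit 'P K w.
    by move=> zK; apply: imsetS; rewrite cycle_subG.
  have /orbit_eqP <- := subsetP (sub x b xK) v vb.
  by rewrite orbit_sym; apply: subsetP (sub y u yK) v vu.
have orbK' : {in D :\ a, forall u, orbit 'P K u = D :\ a}.
  move=> u uD; have /orbit_eqP -> := orbK u uD; apply/eqP; rewrite eqEsubset.
  rewrite acts_sub_orbit // bDa /=; apply/subsetP; exact: orbK.
have := IH (D :\ a) K _ orbK' lt2p' _; rewrite -cD => /(_ leDn).
move=> /(_ (ex_intro _ x (ex_intro _ b _))) dv.
rewrite cD factS -(card_orbit_stab 'P G a) (orbD a aD) cD mulnCA dvdn_pmul2l //.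
by apply: dv; split; rewrite // KP xG xa eqxx.
Qed.

(** [D] is the orbit that contains a nontrivial cycle of an element of order [p];
    the action of [G] on the other points contributes the factorial. *)
Lemma long_cycle_orbit p G : prime p -> #|T| < 2 * p -> p %| #|G| ->
  exists D, [/\ p <= #|D|, #|D|`! %| (p.-1)`! * #|G| &
    #|G| <= (#|T| - #|D|)`! * #|G :&: perm.Sym D|].
Proof.
move=> pp lt2p /(Cauchy pp)[x xG ox].
have [b xb] : exists b, x b != b.
  apply/existsP; rewrite -negb_forall; apply: contraL (prime_gt1 pp) => /forallP fx.
  rewrite -ox (_ : x = 1%g) ?order1 //.
  by apply/permP=> a; rewrite perm1; apply/eqP/fx.
exists (orbit 'P G b); set D := orbit 'P G b.
have ltD : #|D| < 2 * p by apply: leq_ltn_trans lt2p; apply: max_card.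
have bD : b \in D by apply: orbit_refl.
have orbD : {in D, forall a, orbit 'P G a = D} by move=> a /orbit_eqP.
have actsD : G \subset 'N(D | 'P) by apply: acts_orbit; apply: subsetT.
have [Eo po] := prime_order_orbit pp ox (subsetP actsD x xG) ltD bD xb.
split.
- by rewrite -{1}po -Eo subset_leq_card //; apply/subsetP=> u; rewrite inE => /andP[].
- by apply: long_cycle_falling; rewrite //; exists x, b.
have [m dv] := card_set_stab (~: D) (cardS_Sym G).
rewrite -[RHS]/(_ * _) setTD setCK.
have -> : 'N_G(~: D | 'P) = G.
  apply/setIidPl; apply/subsetP=> y yG; apply/astabsP=> u.
  by have /astabsP/(_ u) := subsetP actsD y yG; rewrite !inE => ->.
move=> ->; rewrite leq_mul2r dvdn_leq ?fact_gt0 ?orbT //.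
by rewrite -(cardsC D) addnC addnK in dv *.
Qed.

End LongCycles.

(** * Groups without three-cycles on seven and eight points *)

Section Order210.

Variable gT : finGroupType.
Implicit Types G P K : {group gT}.

(** The automorphism group of a group of order [p] has order [p - 1]. *)
Lemma norm_cent_prime P y p q : prime p -> prime q -> #|P| = p -> #[y] = q ->
  ~~ (q %| p.-1) -> y \in 'N(P) -> y \in 'C(P).
Proof.
move=> pp pq cP oy nq yN; rewrite -ker_conj_aut; apply/kerP => //.
have d1 : #[conj_aut P y] %| q by rewrite -oy morph_order.
have d2 : #[conj_aut P y] %| p.-1.
  rewrite -(totient_prime pp) -cP -card_Aut_cyclic ?prime_cyclic ?cP //.
  exact/order_dvdG/Aut_aut.
case/primeP: pq => _ /(_ _ d1) /orP[|/eqP E]; first by rewrite order_eq1 => /eqP.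
by rewrite -E d2 in nq.
Qed.

Lemma card_prime_order G p : prime p -> #|G|`_p = p ->
  #|[set x in G | #[x] == p]| = #|'Syl_p(G)| * p.-1.
Proof.
move=> pp Gp; rewrite -sum1_card.
rewrite (partition_big (fun x => <[x]>%G) (mem 'Syl_p(G))) /=; last first.
  move=> x; rewrite inE => /andP[xG /eqP ox].
  by rewrite inE pHallE cycle_subG xG -orderE ox Gp eqxx.
rewrite -sum_nat_const; apply: eq_bigr => P; rewrite inE pHallE Gp => /andP[sPG /eqP cP].
have -> : p.-1 = #|P^#| by rewrite -cP (cardsD1 1%g) group1.
rewrite sum1_card; apply: eq_card => x; rewrite unfold_in !inE.
apply/andP/andP => [[/andP[xG /eqP ox] /eqP <-]|[x1 xP]].
  by rewrite cycle_id; split=> //; apply: contraTneq pp => x1; rewrite -ox x1 order1.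
have ox : #[x] = p by apply: nt_prime_order; rewrite // -cP expg_cardG.
rewrite (subsetP sPG) // ox eqxx; split=> //.
by rewrite -val_eqE eqEcard cycle_subG xP cP -ox leqnn.
Qed.

Lemma dvd_cases n m (Q : pred nat) : 0 < m -> all Q (divisors m) -> n %| m -> Q n.
Proof. by move=> m0 /allP h d; apply: h; rewrite -dvdn_divisors. Qed.

(** With 15 Sylow 7-subgroups, the normalisers of the Sylow 5-subgroups and then
    of the Sylow 3-subgroups become so small that there are 70 Sylow
    3-subgroups.  That makes 140 elements of order 3 and 90 of order 7. *)
Lemma order210_Syl7 G : #|G| = 210 -> #|'Syl_7(G)| = 1.
Proof.
move=> G210; have Gp (p : nat) : p \in [:: 3; 5; 7] -> prime p /\ #|G|`_p = p.
  by rewrite G210 !inE => /or3P[] /eqP->; split=> //; rewrite p_part.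
have [p3 G3] := Gp 3 isT; have [p5 G5] := Gp 5 isT; have [p7 G7] := Gp 7 isT.
have sylP (p : nat) : exists2 P : {group gT}, P \subset G /\ #|P| = #|G|`_p &
    #|'Syl_p(G)| * #|'N_G(P)| = 210.
  have [P sylP] := Sylow_exists p G; exists P.
    by split; [exact: pHall_sub sylP | exact: card_Hall sylP].
  by rewrite (card_Syl sylP) mulnC Lagrange ?subsetIl // G210.
have sylN (p : nat) P : p \in [:: 3; 5; 7] -> P \subset G -> #|P| = p ->
    #|'Syl_p(G)| * #|'N_G(P)| = 210.
  move=> /Gp[pp Ep] sPG cP; have sP : p.-Sylow(G) P by rewrite pHallE sPG cP Ep eqxx.
  by rewrite (card_Syl sP) mulnC Lagrange ?subsetIl // G210.
(* An element of order [q] normalising a subgroup of order [p] centralises it,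
   so that [p] divides the order of the normaliser of a Sylow [q]-subgroup *)
have swap (p q : nat) P : p \in [:: 3; 5; 7] -> q \in [:: 3; 5; 7] -> ~~ (q %| p.-1) ->
    P \subset G -> #|P| = p -> q %| #|'N_G(P)| -> p * #|'Syl_q(G)| %| 210.
  move=> pP qP nq sPG cP /(Cauchy (Gp q qP).1)[y /setIP[yG yN] oy].
  have yC := norm_cent_prime (Gp p pP).1 (Gp q qP).1 cP oy nq yN.
  have sY : <[y]> \subset G by rewrite cycle_subG.
  rewrite -(sylN q <[y]>%G qP sY oy) mulnC dvdn_mul // -cP; apply: cardSg.
  rewrite subsetI sPG cents_norm // centsC cycle_subG //.
apply/eqP; apply/negPn/negP=> n7.
have syl_dvd (p : nat) : #|'Syl_p(G)| %| 210 by rewrite -G210 card_Syl_dvd.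
have mod1 (p : nat) : p \in [:: 3; 5; 7] -> #|'Syl_p(G)| %% p = 1.
  by case/Gp=> pp _; apply: card_Syl_mod.
have cases (p : nat) (Q : pred nat) : p \in [:: 3; 5; 7] ->
    all (fun n => (n %% p == 1) ==> Q n) (divisors 210) -> Q #|'Syl_p(G)|.
  move=> pP h; have := @dvd_cases _ 210 _ isT h (syl_dvd p).
  by rewrite (mod1 p pP) eqxx.
have s7 : #|'Syl_7(G)| = 15.
  apply/eqP; move: n7; apply: contraR => n15.
  have := @cases 7 (fun n => (n == 1) || (n == 15)) isT isT.
  by rewrite (negPf n15) orbF.
have [P5 [sP5 cP5] N5] := sylP 5; have [P3 [sP3 cP3] N3] := sylP 3.
have n5 : #|'Syl_5(G)| = 21.
  have /or3P[/eqP E|/eqP E|/eqP//] := @cases 5 (fun n => [|| n == 1, n == 6 | n == 21]) isT isT.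
    have := swap 5 7 P5 isT isT isT sP5 (etrans cP5 G5) _.
    have -> : #|'N_G(P5)| = 210 by move: N5; rewrite E; lia.
    by rewrite s7 => /(_ isT).
  have := swap 5 7 P5 isT isT isT sP5 (etrans cP5 G5) _.
  have -> : #|'N_G(P5)| = 35 by move: N5; rewrite E; lia.
  by rewrite s7 => /(_ isT).
have n3 : #|'Syl_3(G)| = 70.
  have /or4P[/eqP E|/eqP E|/eqP E|/eqP//] :=
    @cases 3 (fun n => [|| n == 1, n == 7, n == 10 | n == 70]) isT isT.
  - have := swap 3 7 P3 isT isT isT sP3 (etrans cP3 G3) _.
    have -> : #|'N_G(P3)| = 210 by move: N3; rewrite E; lia.
    by rewrite s7 => /(_ isT).
  - have := swap 3 5 P3 isT isT isT sP3 (etrans cP3 G3) _.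
    have -> : #|'N_G(P3)| = 30 by move: N3; rewrite E; lia.
    by rewrite n5 => /(_ isT).
  have := swap 3 7 P3 isT isT isT sP3 (etrans cP3 G3) _.
  have -> : #|'N_G(P3)| = 21 by move: N3; rewrite E; lia.
  by rewrite s7 => /(_ isT).
have : #|[set x in G | #[x] == 3] :|: [set x in G | #[x] == 7]| <= 210.
  rewrite -G210 subset_leq_card //; apply/subsetP=> x.
  by rewrite !inE => /orP[] /andP[].
rewrite cardsU (_ : _ :&: _ = set0); last first.
  by apply/setP=> x; rewrite !inE; case: (#[x] =P 3) => [->|]; rewrite ?andbF.
by rewrite cards0 subn0 !card_prime_order // n3 s7.
Qed.

End Order210.

Section SmallOrders.

Variable T : finType.
Implicit Types (a b u v w : T) (s t x y : {perm T}) (S D E : {set T}).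
Implicit Types G H K : {group {perm T}}.

Lemma commute_cycle_fix D x y b : orbit 'P <[x]> b = D -> y \in perm.Sym D ->
  commute x y -> y b = b -> y = 1%g.
Proof.
move=> oD yD xy yb; apply/permP=> u; rewrite perm1.
have [|uD] := boolP (u \in D); last exact: Sym_fix yD uD.
rewrite -oD => /orbitP[_ /cycleP[i ->] <-]; rewrite /= !apermE.
by rewrite -permM -(commuteX i (commute_sym xy)) permM yb.
Qed.

(** As [x] permutes [D] in a single cycle, only the identity of the symmetric
    group on [D] fixes [b] and commutes with [x]: an element of [K] that fixes [b] is
    determined by the conjugate of [x] under it. *)
Lemma normal_cycle_bound D K x b : 1 < #|D| -> #|D| = #[x] -> orbit 'P <[x]> b = D ->
  K \subset perm.Sym D -> K \subset 'N(<[x]>) -> #|K| <= #|D| * #|D|.-1.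
Proof.
move=> D1 cD oD sKD nKx; rewrite -(card_orbit_stab 'P K b) leq_mul //.
  apply: subset_leq_card; apply/subsetP=> _ /orbitP[y yK <-]; rewrite /= apermE.
  by rewrite (Sym_mem _ (subsetP sKD y yK)) -oD orbit_refl.
have inj : {in 'C_K[b | 'P] &, injective (fun y => x ^ y)%g}.
  move=> y z /setIP[yK /astab1P yb] /setIP[zK /astab1P zb] /= E.
  rewrite /= apermE in yb; rewrite /= apermE in zb.
  apply/eqP; rewrite eq_mulgV1; apply/eqP; apply: (commute_cycle_fix oD (b := b)).
  - by rewrite (subsetP sKD) // groupM ?groupV.
  - by apply/commgP/conjg_fixP; rewrite conjgM E conjgK.
  by rewrite permM yb -{1}zb permK.
rewrite cD -(card_in_imset inj) orderE (cardsD1 1%g <[x]>) group1 add1n /=.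
apply: subset_leq_card; apply/subsetP=> _ /imsetP[y /setIP[yK _] ->].
rewrite !inE memJ_norm ?(subsetP nKx) // cycle_id andbT -(conj1g y).
rewrite (inj_eq (@conjg_inj _ y)); apply: contraTneq D1 => x1.
by rewrite cD x1 order1.
Qed.

Lemma Syl_card1_norm (p : nat) G (P : {group {perm T}}) :
  p.-Sylow(G) P -> #|'Syl_p(G)| = 1 -> G \subset 'N(P).
Proof.
move=> sP; rewrite (card_Syl sP) => /eqP; rewrite indexg_eq1.
by rewrite subsetI subxx.
Qed.

(** A normal Sylow 7-subgroup of [K] is generated by a cycle of length 7. *)
Lemma card7_Syl1 D K : #|D| = 7 -> K \subset perm.Sym D -> 7 %| #|K| ->
  #|'Syl_7(K)| = 1 -> #|K| <= 42.
Proof.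
move=> D7 sKD d7 s1; have [P sylP] := Sylow_exists 7 K.
have nKP := Syl_card1_norm sylP s1.
have dK : #|K| %| 7`! by rewrite -D7 -perm.card_Sym; apply: cardSg.
have K7 : #|K|`_7 = 7.
  apply/eqP; rewrite eqn_dvd; apply/andP; split; last first.
    by rewrite -[X in X %| _](@part_pnat_id 7 7) // partn_dvd // cardG_gt0.
  by apply: dvdn_trans (partn_dvd 7 _ dK) _; rewrite ?fact_gt0 // p_part.
have cP : #|P| = 7 by rewrite (card_Hall sylP).
have /cyclicP[x EP] : cyclic P by rewrite prime_cyclic ?cP.
have ox : #[x] = 7 by rewrite orderE -EP.
have xK : x \in K by rewrite (subsetP (pHall_sub sylP)) // EP cycle_id.
have [b xb] : exists b, x b != b.
  apply/existsP; rewrite -negb_forall; apply/negP=> /forallP fx.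
  suff x1 : x = 1%g by rewrite x1 order1 in ox.
  by apply/permP=> a; rewrite perm1; apply/eqP/fx.
have bD : b \in D by apply: contraR xb => /(Sym_fix (subsetP sKD x xK)) ->.
have nD : x \in 'N(D | 'P).
  by apply/astabsP=> u; rewrite /= apermE (Sym_mem _ (subsetP sKD x xK)).
have lt7 : #|D| < 2 * 7 by rewrite D7.
have [Eo po] := @prime_order_orbit _ 7 x D b isT ox nD lt7 bD xb.
have oD : orbit 'P <[x]> b = D.
  apply/eqP; rewrite eqEcard po D7 leqnn andbT -Eo.
  by apply/subsetP=> u; rewrite inE => /andP[].
have := @normal_cycle_bound D K x b _ _ oD sKD _; rewrite D7 ox -EP; exact.
Qed.

(** The orders up to Bochert's bound 210 that exceed 168 or equal 84 are excluded
    by divisibility, or because they force a normal Sylow 7-subgroup.  The value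
    168 is the order of PSL(2,7) in its action on seven points. *)
Lemma card7_free D K : #|D| = 7 -> K \subset perm.Sym D -> cyc3_free K ->
  #|K| <= 168 /\ #|K| != 84.
Proof.
move=> D7 sKD free.
have le := cyc3_free_bound sKD free; rewrite D7 in le.
have dv : #|K| %| 1680.
  by rewrite -(@dvdn_pmul2l 3) // -[3 * 1680]/(7`!) -D7 cyc3_free_dvd3 // D7.
have no : 7 %| #|K| -> #|'Syl_7(K)| = 1 -> #|K| <= 42 by apply: card7_Syl1 sKD.
have n210 : #|K| != 210.
  apply/eqP=> K210; move: no; rewrite (order210_Syl7 K210) K210.
  by move=> /(_ isT erefl).
have n84 : #|K| != 84.
  apply/eqP=> K84; move: no; rewrite K84 => /(_ isT) no.
  have mod1 : #|'Syl_7(K)| %% 7 = 1 by apply: card_Syl_mod.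
  have := @dvd_cases _ 84 (fun n => (n %% 7 == 1) ==> (n == 1)) isT isT.
  move=> /(_ #|'Syl_7(K)|); rewrite mod1 -{1}K84 card_Syl_dvd => /(_ isT)/eqP/no.
  by [].
split=> //.
have := @dvd_cases _ 1680 (fun n => (n <= 210) ==> (n != 210) ==> (n <= 168)) isT isT dv.
by rewrite n210 -(@leq_pmul2r 24) // (leq_trans le).
Qed.

(** The value for eight points is the order of AGL(3,2); it is [8 * 168], a
    point stabiliser being a group without three-cycles on seven points. *)
Definition max_free (k : nat) : N :=
  if k == 7 then 168%num else if k == 8 then 1344%num
  else (factN k / factN (uphalf k))%num.

Lemma max_freeP D K : K \subset perm.Sym D -> cyc3_free K ->
  #|K| <= N.to_nat (max_free #|D|).
Proof.
move=> sKD free; rewrite /max_free; case: eqP => [D7|_]; first by have [] := card7_free D7 sKD free.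
case: eqP => [D8|_]; last exact: bochert_quotient.
have /card_gt0P[a aD] : 0 < #|D| by rewrite D8.
rewrite -(card_orbit_stab 'P K a) -[N.to_nat _]/(8 * 168) leq_mul //.
  rewrite -D8; apply: subset_leq_card; apply/subsetP=> _ /orbitP[y yK <-].
  by rewrite /= apermE (Sym_mem _ (subsetP sKD y yK)).
have D7 : #|D :\ a| = 7 by move: D8; rewrite (cardsD1 a) aD => -[].
have sKa : 'C_K[a | 'P] \subset perm.Sym (D :\ a).
  apply/subsetP=> y /setIP[/(subsetP sKD) yD /astab1P /=]; rewrite apermE => ya.
  rewrite inE; apply/subsetP=> u yu.
  have: u \in D by move: yu; apply: contraR => /(Sym_fix yD) /eqP.
  by rewrite !inE => ->; rewrite andbT; apply: contra yu => /eqP->; rewrite ya.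
have [|//] := @card7_free _ ('C_K[a | 'P])%G D7 sKa.
by move=> u v w U; apply: contra (free u v w U) => /setIP[].
Qed.

(** A proper subgroup of a simple group embeds that group in the symmetric group
    on its cosets. *)
Lemma simple_index_dvd (gT : finGroupType) (G H : {group gT}) : simple G -> H \proper G ->
  #|G| %| #|G : H|`!.
Proof.
move=> /simpleP[_ sG] /andP[sHG nGH].
have nSG : [acts G, on rcosets H G | 'Rs].
  by rewrite -orbitRs; apply: acts_orbit; apply: subsetT.
have core1 : gcore H G = 1%g.
  have [//|E] := sG [group of gcore H G] (gcore_normal sHG).
  by case/negP: nGH; rewrite -E gcore_sub.
pose f := actperm_morphism <[nSG]>%act.
have injf : 'injm f.
  rewrite ker_actperm astab_actby setIT astabRs_rcosets core1.
  exact: subsetIr.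
rewrite -(card_injm injf (subxx G)) /indexg -perm.card_Sym; apply: cardSg.
apply/subsetP=> _ /morphimP[y _ yG ->]; rewrite inE; apply/subsetP=> U.
rewrite inE; apply: contraR => nU; apply/eqP.
by rewrite actpermE /= /actby (negPf nU).
Qed.

End SmallOrders.

(** * Enumeration of the admissible orders *)

Definition divN (a b : N) : bool := (b mod a =? 0)%num.

Definition sumN (s : seq N) : N := foldr N.add 0%num s.

Definition powsN (p e : nat) : seq N := [seq (N.of_nat p ^ N.of_nat i)%num | i <- iota 0 e.+1].

Definition divisorsN (f : seq (nat * nat)) : seq N :=
  foldr (fun pe s => [seq (x * y)%num | x <- powsN pe.1 pe.2, y <- s]) [:: 1%num] f.

Definition valN (f : seq (nat * nat)) : N :=
  foldr (fun pe x => (N.of_nat pe.1 ^ N.of_nat pe.2 * x)%num) 1%num f.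

(** The factorisation of [2 ^ u * n`! / 2] for [1 < n < 29], or for [n < 2] and
    [0 < u], by Legendre's formula. *)
Definition fact_facs (u n : nat) : seq (nat * nat) :=
  [seq (p, n %/ p + n %/ p ^ 2 + n %/ p ^ 3 + n %/ p ^ 4 + (p == 2) * u - (p == 2))
  | p <- [:: 2; 3; 5; 7; 11; 13; 17; 19; 23] & (p <= n) || (p == 2)].

(** The three cases of [class_trichotomy], read as conditions on an order [d]. *)
Definition giantN (c n : nat) (d : N) : bool :=
  has (fun k => [&& 2 < k, n < k * 2, divN (factN k) (2 * d)
    & divN (N.of_nat c * d) (factN k * factN (n - k))]) (iota 0 n.+1).

Definition midN (c n : nat) (d : N) : bool :=
  has (fun e => has (fun m => has (fun j =>
    [&& divN (N.of_nat c * d) (N.of_nat j * (factN e * factN (n - e))),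
        (d <=? stripcap e m n)%num
      & ((e * 2 == n) && (m == 2)) ==> divN (factN e ^ 2) (4 * d)])
    (iota 1 m)) (iota 1 (n %/ e))) (iota 3 (n./2 - 2)).

Definition long_cycle_okN (n p : nat) (d : N) : bool :=
  (n < 2 * p) && divN (N.of_nat p) d ==>
  has (fun k => [&& p <= k, divN (factN k) (factN p.-1 * d)
    & (d <=? factN (n - k) * max_free k)%num]) (iota 0 n.+1).

(** Besides Bochert's bound and the missing factor 3 of [cyc3_free_dvd3], the
    conditions are those for seven and eight points, the absence of subgroups of
    index 3 in the simple alternating groups, and high transitivity in the
    presence of elements of order 5 or 7. *)
Definition freeN (c n : nat) (d : N) : bool :=
  [&& (d * factN (uphalf n) <=? factN n)%num,
      divN (3 * N.of_nat c * d) (factN n),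
      (d <=? max_free n)%num,
      ~~ ((n == 7) && (d =? 84)%num),
      ~~ [&& c == 2, 4 < n < 7 & (6 * d =? factN n)%num],
      long_cycle_okN n 5 d & long_cycle_okN n 7 d].

Definition admissibleN (c n : nat) (d : N) : bool :=
  [|| giantN c n d, midN c n d | freeN c n d].

Definition small_sum (c n : nat) : N :=
  sumN [seq d <- divisorsN (fact_facs (2 - c) n) | admissibleN c n d].

(** The orders of giants, with [k] the size of the large class; a list that is
    read off from this description is much shorter than the list of
    all divisors of [n`!]. *)
Definition giant_list (c n : nat) : seq N :=
  flatten [seq [seq (factN k * i / 2)%num | i <- divisorsN (fact_facs (3 - c) (n - k))]
          | k <- iota 0 n.+1 & n < k * 2].

(** The orders of groups with two classes of [n / 2] points each: such an order is
    [(n / 2)`! ^ 2 / 4] times a divisor of 8. *)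
Definition half_list (c n : nat) : seq N :=
  if odd n then [::] else [seq (factN n./2 ^ 2 * i / 4)%num | i <- [:: 1; 2; 4; 8]%num].

Definition rest_cap (n : nat) : N :=
  maxN (flatten [seq [seq stripcap e m n | m <- iota 1 (n %/ e) & ~~ ((e * 2 == n) && (m == 2))]
       | e <- iota 3 (n./2 - 2)]).

Definition rest_list (c n : nat) : seq N :=
  let R := rest_cap n in let A := (factN n / factN (uphalf n))%num in
  [seq d <- divisorsN (fact_facs (2 - c) n)
  | (d <=? R)%num || (d <=? A)%num && divN (3 * N.of_nat c * d) (factN n)].

Definition medium_sum c n := (sumN (giant_list c n) + sumN (half_list c n) + sumN (rest_list c n))%num.

Lemma divNE a b : divN a b = (N.to_nat a %| N.to_nat b).
Proof.
rewrite /divN; apply/idP/dvdnP => [/N.eqb_eq E|[q Eq]].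
  exists (N.to_nat (b / a)); have := N.div_mod' b a; rewrite E N.add_0_r => {1}->.
  by rewrite Nnat.N2Nat.inj_mul mulnC.
apply/N.eqb_eq; have -> : b = (N.of_nat q * a)%num by apply: Nnat.N2Nat.inj; lia.
by rewrite N.Div0.mod_mul.
Qed.

Lemma sumNE s : N.to_nat (sumN s) = \sum_(x <- s) N.to_nat x.
Proof. by elim: s => [|x s IH]; rewrite ?big_nil // big_cons -IH /= Nnat.N2Nat.inj_add. Qed.

Lemma sum_uniq_sub (I : eqType) (F : I -> nat) (s L : seq I) : uniq s ->
  {subset s <= L} -> \sum_(x <- s) F x <= \sum_(x <- L) F x.
Proof.
elim: s L => [|d s IH] L; first by rewrite big_nil.
rewrite /= => /andP[ds us] sub; have dL := sub d (mem_head _ _).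
rewrite (perm_big _ (perm_to_rem dL)) !big_cons leq_add2l.
apply: IH => // x xs; have : x \in L by rewrite sub // inE xs orbT.
rewrite (perm_mem (perm_to_rem dL)) inE => /orP[/eqP E|//].
by rewrite -E xs in ds.
Qed.

Lemma sum_uniq_le (s : seq nat) (L : seq N) : uniq s ->
  (forall d, d \in s -> N.of_nat d \in L) -> \sum_(d <- s) d <= N.to_nat (sumN L).
Proof.
move=> us sub; rewrite sumNE.
have -> : \sum_(d <- s) d = \sum_(x <- map N.of_nat s) N.to_nat x.
  by rewrite big_map; apply: eq_bigr => d _; rewrite Nnat.Nat2N.id.
apply: sum_uniq_sub; first by rewrite map_inj_uniq //; apply: Nnat.Nat2N.inj.
by move=> x /mapP[d /sub dL ->].
Qed.

Lemma dvdn_prime_power_mul p e m d : prime p -> d %| p ^ e * m ->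
  exists i d', [/\ i <= e, d' %| m & d = p ^ i * d'].
Proof.
move=> pp dv; have [i lei Eg] : exists2 i, i <= e & gcdn d (p ^ e) = p ^ i.
  by apply/dvdn_pfactor => //; apply: dvdn_gcdr.
have g0 : 0 < gcdn d (p ^ e) by rewrite Eg expn_gt0 prime_gt0.
exists i, (d %/ gcdn d (p ^ e)); split=> //; last by rewrite -Eg mulnC divnK ?dvdn_gcdl.
have co : coprime (d %/ gcdn d (p ^ e)) (p ^ e %/ gcdn d (p ^ e)).
  by rewrite /coprime -(eqn_pmul2r g0) muln_gcdl !divnK ?dvdn_gcdl ?dvdn_gcdr // mul1n.
by rewrite -(Gauss_dvdr _ co) -(dvdn_pmul2r g0) divnK ?dvdn_gcdl // mulnAC divnK ?dvdn_gcdr.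
Qed.

Lemma N_pow p e : N.to_nat (N.of_nat p ^ N.of_nat e) = p ^ e.
Proof.
elim: e => // e IHe; rewrite Nnat.Nat2N.inj_succ N.pow_succ_r' expnS -IHe.
by rewrite Nnat.N2Nat.inj_mul Nnat.Nat2N.id.
Qed.

Lemma valN_divisors f (d : nat) : all (fun pe => prime pe.1) f ->
  d %| N.to_nat (valN f) -> N.of_nat d \in divisorsN f.
Proof.
elim: f d => [|[p e] f IH] d /=; first by move=> _; rewrite dvdn1 => /eqP->.
move=> /andP[pp af]; rewrite Nnat.N2Nat.inj_mul N_pow.
case/(dvdn_prime_power_mul pp)=> i [d' [lei dv' Ed]].
change (N.of_nat d \in [seq (x * y)%num | x <- powsN p e, y <- divisorsN f]).
apply/allpairsPdep; exists (N.of_nat p ^ N.of_nat i)%num, (N.of_nat d'); split.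
- by apply/mapP; exists i; rewrite // mem_iota.
- exact: IH.
by apply: Nnat.N2Nat.inj; rewrite Nnat.Nat2N.id Nnat.N2Nat.inj_mul Nnat.Nat2N.id N_pow.
Qed.

(** * Orders of permutation groups are admissible *)

Section Admissible.

Variable T : finType.
Implicit Types G H K : {group {perm T}}.

Lemma within_dvd (c : nat) G : within c G -> 1 < #|T| -> c * #|G| %| #|T|`!.
Proof.
move=> /orP[/eqP->|/andP[/eqP-> sGA]] T1.
  by rewrite mul1n -card_Sym; apply/cardSg/subsetT.
by rewrite -(card_Alt T1) dvdn_pmul2l //; apply: cardSg.
Qed.

Lemma free_dvd3 (c : nat) G : within c G -> cyc3_free G -> 2 < #|T| ->
  3 * c * #|G| %| #|T|`!.
Proof.
move=> cG free T2; have sGT := cardS_Sym G.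
have d3 : 3 * #|G| %| #|T|`!.
  by rewrite -cardsT cyc3_free_dvd3 // cardsT.
have := within_dvd cG (ltnW T2); case/orP: cG => [/eqP->|/andP[/eqP-> _]]; first by rewrite muln1.
case/dvdnP: d3 => q ->; rewrite mulnA !dvdn_pmul2r // (Gauss_dvdl _ (isT : coprime 2 3)) => d2.
by rewrite mulnC dvdn_pmul2r.
Qed.

Lemma giantN_in (c k : nat) G : 2 < k -> #|T| < k * 2 -> k <= #|T| ->
  k`! %| 2 * #|G| -> c * #|G| %| k`! * (#|T| - k)`! -> giantN c #|T| (N.of_nat #|G|).
Proof.
move=> k2 lk kn d1 d2; apply/hasP; exists k; first by rewrite mem_iota ltnS.
by rewrite k2 lk !divNE !Nnat.N2Nat.inj_mul !factN_nat !Nnat.Nat2N.id /= d1.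
Qed.

Lemma midN_in (c e m j : nat) G : 2 < e -> e * 2 <= #|T| -> 0 < j <= m -> m * e <= #|T| ->
  c * #|G| %| j * (e`! * (#|T| - e)`!) -> #|G| <= N.to_nat (stripcap e m #|T|) ->
  (e * 2 = #|T| -> m = 2 -> e`! ^ 2 %| 4 * #|G|) -> midN c #|T| (N.of_nat #|G|).
Proof.
move=> e2 en jm me d1 le d2; apply/hasP; exists e; first by rewrite mem_iota; lia.
apply/hasP; exists m; first by rewrite mem_iota add1n ltnS leq_divRL ?me ?andbT; lia.
apply/hasP; exists j; first by rewrite mem_iota; lia.
apply/and3P; split.
- by rewrite !divNE !Nnat.N2Nat.inj_mul !factN_nat !Nnat.Nat2N.id.
- by apply/N.leb_spec0; lia.
apply/implyP=> /andP[/eqP E2 /eqP m2].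
by rewrite !divNE Nnat.N2Nat.inj_mul Nnat.Nat2N.id (factN_pow e 2) d2.
Qed.

Lemma long_cycle_ok p G : prime p -> cyc3_free G ->
  long_cycle_okN #|T| p (N.of_nat #|G|).
Proof.
move=> pp free; apply/implyP=> /andP[lt]; rewrite divNE !Nnat.Nat2N.id => dp.
have [D [pD dv le]] := long_cycle_orbit pp lt dp.
have freeD : cyc3_free (G :&: perm.Sym D)%G.
  by move=> u v w U; apply: contra (free u v w U) => /setIP[].
have leD := max_freeP (subsetIr _ _ : (G :&: perm.Sym D)%G \subset perm.Sym D) freeD.
apply/hasP; exists #|D|; first by rewrite mem_iota ltnS max_card.
rewrite pD divNE Nnat.N2Nat.inj_mul !factN_nat Nnat.Nat2N.id dv /=.
apply/N.leb_spec0/N_leq; rewrite Nnat.Nat2N.id Nnat.N2Nat.inj_mul factN_nat.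
exact: leq_trans le (leq_mul (leqnn _) leD).
Qed.

Lemma freeN_in (c : nat) G : within c G -> cyc3_free G -> 4 < #|T| ->
  freeN c #|T| (N.of_nat #|G|).
Proof.
move=> cG free T4; have sGT := cardS_Sym G.
have le := cyc3_free_bound sGT free; rewrite cardsT in le.
apply/and5P; split.
- by apply/N.leb_spec0; move: le; rewrite -!factN_nat; nia.
- rewrite divNE !Nnat.N2Nat.inj_mul !factN_nat !Nnat.Nat2N.id.
  by apply: free_dvd3 => //; lia.
- by apply/N.leb_spec0; have := max_freeP sGT free; rewrite cardsT; lia.
- apply/negP=> /andP[/eqP T7 /N.eqb_eq G84].
  have [|_] := card7_free _ sGT free; first by rewrite cardsT.
  by case/eqP; lia.
apply/and3P; split; last 2 first.
- exact: long_cycle_ok.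
- exact: long_cycle_ok.
apply/negP=> /and3P[/eqP c2 /andP[_ T7] /N.eqb_eq E].
have {}E : 6 * #|G| = #|T|`! by rewrite -factN_nat; lia.
move: cG; rewrite c2 /within /= => sGA.
have cA : #|'Alt_T| = 3 * #|G|.
  by have := card_Alt (ltn_trans (isT : 1 < 4) T4); rewrite -E; lia.
have prop : G \proper 'Alt_T.
  by rewrite properEcard sGA cA -{1}(mul1n #|G|) ltn_pmul2r ?cardG_gt0.
have := simple_index_dvd (simple_Alt5 T4) prop.
rewrite -divgS // cA mulnK ?cardG_gt0 // => /dvdn_leq -/(_ isT); rewrite -[3`!]/6.
suff : 5`! <= 6 * #|G| by rewrite -[5`!]/120; lia.
by rewrite E leq_fact.
Qed.

Lemma admissible_in (c : nat) G : within c G -> 4 < #|T| ->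
  admissibleN c #|T| (N.of_nat #|G|).
Proof.
move=> cG T4; case: (class_trichotomy cG) => [free|[k []]|[e [m [j [[] *]]]]].
- by rewrite /admissibleN freeN_in ?orbT.
- by move=> *; rewrite /admissibleN (@giantN_in _ k).
by rewrite /admissibleN (@midN_in _ e m j) ?orbT.
Qed.

End Admissible.

(** * Summation for degrees up to 25 *)

(** The number of divisors of [n`! / c] times a bound for the orders not listed
    explicitly. *)
Definition large_sum (c n : nat) : N :=
  (sumN (giant_list c n) + sumN (half_list c n) +
   foldr (fun pe x => N.of_nat pe.2.+1 * x) 1 (fact_facs (2 - c) n) *
   N.max (rest_cap n) (factN n / factN (uphalf n)))%num.

(** The three bounds are increasingly crude and increasingly fast to evaluate:
    for few points all conditions are needed, for many points the divisors of
    [n`!] are too numerous to be listed. *)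
Definition order_sum_bound (c n : nat) : N :=
  if n <= 10 then small_sum c n else if n <= 16 then medium_sum c n else large_sum c n.

Definition check_facs (c n : nat) : bool :=
  [&& (N.of_nat c * valN (fact_facs (2 - c) n) =? factN n)%num,
      all (fun r => (N.of_nat c * valN (fact_facs (3 - c) r) =? 2 * factN r)%num) (iota 0 n./2.+1)
    & all (fun pe => prime pe.1) (fact_facs (2 - c) n)].

(** The bounds [5 / 2], [2], [11 / 6] and [4 / 3] for [J], in terms of the sum of
    the orders; for the alternating groups this sum is compared with [n`!], the
    double of the group order. *)
Definition check_bound (c n : nat) : bool :=
  check_facs c n &&
  if c == 1 then
    if n < 7 then (2 * order_sum_bound c n <? 5 * factN n)%num
    else (order_sum_bound c n <? 2 * factN n)%num
  else if n < 9 then (12 * order_sum_bound c n <? 11 * factN n)%num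
    else (6 * order_sum_bound c n <? 4 * factN n)%num.

Lemma check_bound_true : all (fun n => check_bound 1 n && check_bound 2 n) (iota 5 21).
Proof. by vm_compute. Qed.

Lemma size_divisorsN f :
  N.of_nat (size (divisorsN f)) = foldr (fun pe x => N.of_nat pe.2.+1 * x)%num 1%num f.
Proof.
elim: f => // -[p e] f IH; rewrite [RHS]/= -IH.
have -> : size (divisorsN ((p, e) :: f)) = e.+1 * size (divisorsN f).
  by rewrite [LHS](size_allpairs _ (powsN p e)) size_map size_iota.
by rewrite Nnat.Nat2N.inj_mul.
Qed.

Lemma sum_le_size (s : seq nat) m : {in s, forall d, d <= m} -> \sum_(d <- s) d <= size s * m.
Proof.
elim: s => [|d s IH] le; rewrite ?big_nil // big_cons mulSn leq_add ?le ?mem_head //.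
by apply: IH => x xs; rewrite le // inE xs orbT.
Qed.

Lemma maxN_in s x d : x \in s -> d <= N.to_nat x -> (N.of_nat d <= maxN s)%num.
Proof. by move=> /maxN_ge le dx; have := leq_trans dx le; lia. Qed.

Lemma sum_filter2 (P : pred nat) (s : seq nat) :
  \sum_(d <- s) d = \sum_(d <- [seq d <- s | P d]) d + \sum_(d <- [seq d <- s | ~~ P d]) d.
Proof. by rewrite !big_filter (bigID P). Qed.

Section OrderSums.

Variable T : finType.
Implicit Types G H K : {group {perm T}}.

Definition orders_within (c : nat) (s : seq nat) : Prop :=
  forall d, d \in s -> exists2 G : {group {perm T}}, within c G & d = #|G|.

Lemma within_c (c : nat) G : within c G -> (c == 1) || (c == 2).
Proof. by case/orP=> [->//|/andP[-> _]]; rewrite orbT. Qed.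

Lemma order_divisorN (c : nat) G : within c G -> check_facs c #|T| -> 1 < #|T| ->
  N.of_nat #|G| \in divisorsN (fact_facs (2 - c) #|T|).
Proof.
move=> cG /and3P[/N.eqb_eq E _ pr] T1; apply: valN_divisors => //.
have := within_dvd cG T1; rewrite -factN_nat -E Nnat.N2Nat.inj_mul Nnat.Nat2N.id.
by rewrite dvdn_pmul2l //; case/orP: (within_c cG) => /eqP->.
Qed.

Lemma giant_list_in (c k : nat) G : within c G -> check_facs c #|T| ->
  2 < k -> #|T| < k * 2 -> k <= #|T| ->
  k`! %| 2 * #|G| -> c * #|G| %| k`! * (#|T| - k)`! ->
  N.of_nat #|G| \in giant_list c #|T|.
Proof.
move=> cG /and3P[_ /allP facs _] k2 lk kn /dvdnP[i Ei] dv.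
have c0 : 0 < c by case/orP: (within_c cG) => /eqP->.
have /N.eqb_eq E : (N.of_nat c * valN (fact_facs (3 - c) (#|T| - k)) =? 2 * factN (#|T| - k))%num.
  by apply: facs; rewrite mem_iota; lia.
apply/flatten_mapP; exists k; first by rewrite mem_filter mem_iota lk; lia.
apply/mapP; exists (N.of_nat i).
  apply: valN_divisors.
    by apply/allP=> pe /mapP[p]; rewrite mem_filter => /andP[_ pP] ->; move: p pP; apply/allP.
  have {}E : c * N.to_nat (valN (fact_facs (3 - c) (#|T| - k))) = 2 * (#|T| - k)`!.
    by move/(congr1 N.to_nat): E; rewrite !Nnat.N2Nat.inj_mul Nnat.Nat2N.id factN_nat.
  rewrite -(dvdn_pmul2l c0) E.
  have : c * (2 * #|G|) %| 2 * (k`! * (#|T| - k)`!) by rewrite mulnCA dvdn_pmul2l.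
  by rewrite Ei mulnA mulnCA [k`! * _]mulnC dvdn_pmul2r ?fact_gt0.
have -> : (factN k * N.of_nat i)%num = (N.of_nat #|G| * 2)%num.
  by apply: Nnat.N2Nat.inj; rewrite !Nnat.N2Nat.inj_mul factN_nat !Nnat.Nat2N.id; lia.
by rewrite N.div_mul.
Qed.

Lemma half_list_in (c e j : nat) G : within c G -> 2 < e -> e * 2 = #|T| -> 0 < j <= 2 ->
  c * #|G| %| j * (e`! * (#|T| - e)`!) -> e`! ^ 2 %| 4 * #|G| ->
  N.of_nat #|G| \in half_list c #|T|.
Proof.
move=> cG e2 en j2 dv /dvdnP[i Ei].
have c0 : 0 < c by case/orP: (within_c cG) => /eqP->.
have {dv} i8 : i %| 8.
  have : c * (4 * #|G|) %| 4 * (2 * e`! ^ 2).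
    rewrite mulnCA dvdn_pmul2l //; apply: dvdn_trans dv _.
    rewrite (_ : #|T| - e = e) -?mulnn ?dvdn_mul //; last by rewrite -en; lia.
    by case: j j2 => [|[|[]]].
  rewrite Ei mulnA [4 * (_ * _)]mulnA dvdn_pmul2r ?expn_gt0 ?fact_gt0 //.
  by apply: dvdn_trans; apply: dvdn_mull.
have [Ee oT] : e = #|T|./2 /\ odd #|T| = false by rewrite -en muln2 doubleK odd_double.
rewrite /half_list oT; apply/mapP; exists (N.of_nat i).
  have : i \in divisors 8 by rewrite -dvdn_divisors.
  by rewrite (_ : divisors 8 = [:: 1; 2; 4; 8]) // !inE => /or4P[] /eqP->.
have -> : (factN #|T|./2 ^ 2 * N.of_nat i)%num = (N.of_nat #|G| * 4)%num.
  apply: Nnat.N2Nat.inj; rewrite !Nnat.N2Nat.inj_mul (factN_pow _ 2) !Nnat.Nat2N.id.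
  by rewrite -en muln2 doubleK; lia.
by rewrite N.div_mul.
Qed.

Lemma rest_cap_in (e m : nat) d : 2 < e -> e * 2 <= #|T| -> 0 < m -> m * e <= #|T| ->
  ~~ ((e * 2 == #|T|) && (m == 2)) -> d <= N.to_nat (stripcap e m #|T|) ->
  (N.of_nat d <= rest_cap #|T|)%num.
Proof.
move=> e2 en m0 me nh; apply: maxN_in; apply/flatten_mapP; exists e.
  by rewrite mem_iota; lia.
apply/mapP; exists m => //; rewrite mem_filter nh mem_iota add1n ltnS leq_divRL ?me ?andbT; lia.
Qed.

(** The trichotomy in a form that avoids testing all divisors: the orders of the
    giants and of the groups with two classes of half the points are listed, and
    all others are small. *)
Lemma order_cases (c : nat) G : within c G -> check_facs c #|T| -> 4 < #|T| ->
  [\/ N.of_nat #|G| \in giant_list c #|T|, N.of_nat #|G| \in half_list c #|T|,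
     (N.of_nat #|G| <= rest_cap #|T|)%num
   | (N.of_nat #|G| <= factN #|T| / factN (uphalf #|T|))%num /\
     divN (3 * N.of_nat c * N.of_nat #|G|) (factN #|T|)].
Proof.
move=> cG facs T4; case: (class_trichotomy cG) => [free|[k [? ? ? ? ?]]|].
- constructor 4; have /and5P[le d3 _ _ _] := freeN_in cG free T4; split=> //.
  have := bochert_quotient (cardS_Sym G) free; rewrite cardsT; lia.
- by constructor 1; apply: (@giant_list_in _ k).
case=> [e [m [j [[e2 en jm me] dv le two _]]]].
have [/andP[/eqP E2 /eqP m2]|nh] := boolP ((e * 2 == #|T|) && (m == 2)).
  have j2 : 0 < j <= 2 by rewrite -m2.
  by constructor 2; exact: half_list_in cG e2 E2 j2 dv (two E2 m2).
by constructor 3; apply: (@rest_cap_in e m) => //; lia.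
Qed.

Lemma order_sum_bounded (c : nat) s : (c == 1) || (c == 2) -> check_facs c #|T| -> 4 < #|T| ->
  uniq s -> orders_within c s ->
  \sum_(d <- s) d <= N.to_nat (order_sum_bound c #|T|).
Proof.
move=> c12 facs T4 us os; have T1 : 1 < #|T| by apply: ltn_trans T4.
have odiv d : d \in s -> N.of_nat d \in divisorsN (fact_facs (2 - c) #|T|).
  by case/os=> G cG ->; apply: order_divisorN.
rewrite /order_sum_bound; case: ifP => _.
  apply: sum_uniq_le => // d ds; rewrite mem_filter odiv // andbT.
  by case: (os d ds) => G cG ->; apply: admissible_in.
have cases d : d \in s ->
    [\/ N.of_nat d \in giant_list c #|T|, N.of_nat d \in half_list c #|T|,
     (N.of_nat d <= rest_cap #|T|)%num
   | (N.of_nat d <= factN #|T| / factN (uphalf #|T|))%num /\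
     divN (3 * N.of_nat c * N.of_nat d) (factN #|T|)].
  by case/os=> G cG ->; apply: order_cases.
case: ifP => _.
  rewrite /medium_sum (_ : _ + _ + _ = sumN (giant_list c #|T| ++ half_list c #|T| ++ rest_list c #|T|))%num.
    apply: sum_uniq_le => // d ds; rewrite !mem_cat.
    case: (cases d ds) => [-> //|->|le|[le d3]]; rewrite ?orbT //.
      by rewrite /rest_list mem_filter odiv // (introT (N.leb_spec0 _ _) le) !orbT.
    by rewrite /rest_list mem_filter odiv // (introT (N.leb_spec0 _ _) le) d3 !orbT.
  by apply: Nnat.N2Nat.inj; rewrite !Nnat.N2Nat.inj_add !sumNE !big_cat /=; lia.
pose L := giant_list c #|T| ++ half_list c #|T|.
rewrite (sum_filter2 (fun d => N.of_nat d \in L)) /large_sum !Nnat.N2Nat.inj_add.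
apply: leq_add.
  rewrite (_ : N.to_nat _ + N.to_nat _ = N.to_nat (sumN L))%coq_nat.
    by apply: sum_uniq_le; rewrite ?filter_uniq // => d; rewrite mem_filter => /andP[].
  by rewrite !sumNE big_cat.
set R := N.max _ _.
have leR : {in [seq d <- s | N.of_nat d \notin L], forall d, d <= N.to_nat R}.
  move=> d; rewrite mem_filter mem_cat negb_or => /andP[/andP[/negP ng /negP nh] ds].
  by case: (cases d ds) => [//|//|le|[le _]]; rewrite /R; lia.
apply: leq_trans (sum_le_size leR) _.
rewrite -size_divisorsN Nnat.N2Nat.inj_mul Nnat.Nat2N.id leq_mul2r; apply/orP; right.
rewrite -(size_map N.of_nat); apply: uniq_leq_size.
  by rewrite map_inj_uniq ?filter_uniq //; apply: Nnat.Nat2N.inj.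
by move=> x /mapP[d]; rewrite mem_filter => /andP[_ ds] ->; apply: odiv.
Qed.

End OrderSums.

(** * The number of divisors of a factorial *)

Definition tau n := size (divisors n).

Lemma tau_prime_power p e m : prime p -> 0 < m -> ~~ (p %| m) ->
  tau (p ^ e * m) = e.+1 * tau m.
Proof.
move=> pp m0 npm; have p0 := prime_gt0 pp.
have pm0 : 0 < p ^ e * m by rewrite muln_gt0 expn_gt0 p0.
rewrite -[e.+1](size_iota 0) -(size_allpairs (fun i d => p ^ i * d)); apply: perm_size.
apply: uniq_perm; first exact: divisors_uniq.
  apply: allpairs_uniq; rewrite ?iota_uniq ?divisors_uniq //.
  have log0 d : d %| m -> 0 < d /\ logn p d = 0.
    move=> dm; have d0 := dvdn_gt0 m0 dm; split=> //.
    by apply/eqP; rewrite -leqn0 leqNgt logn_gt0 mem_primes pp d0; apply: contra npm => /dvdn_trans; apply.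
  move=> x y /allpairsP[[i d] [_ dm ->]] /allpairsP[[j d'] [_ dm' ->]] /= E.
  rewrite /= -dvdn_divisors // in dm; rewrite /= -dvdn_divisors // in dm'.
  have [[d0 ld] [d'0 ld']] := (log0 d dm, log0 d' dm').
  have Eij : i = j.
    have /(congr1 (logn p)) := E; rewrite !lognM ?expn_gt0 ?p0 // !pfactorK // ld ld'.
    by rewrite !addn0.
  by move/eqP: E; rewrite Eij eqn_pmul2l ?expn_gt0 ?p0 // => /eqP->.
move=> d; rewrite -dvdn_divisors //; apply/idP/allpairsP => [|[[i d'] [iI dv ->]]].
  case/(dvdn_prime_power_mul pp)=> i [d' [lei dv Ed]]; exists (i, d').
  by rewrite mem_iota ltnS lei -dvdn_divisors.
rewrite mem_iota in iI; rewrite -dvdn_divisors // in dv.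
by apply: dvdn_mul => //; apply: dvdn_exp2l.
Qed.

(** An additional factor [p] raises an exponent [v] to [v + 1], hence multiplies
    the number of divisors by [(v + 2) / (v + 1)]. *)
Lemma tau_mul_prime p m : prime p -> 0 < m ->
  tau (p * m) * (logn p m).+1 = (logn p m).+2 * tau m.
Proof.
move=> pp m0; have [u nu Em] := pfactor_coprime pp m0.
have nd : ~~ (p %| u) by rewrite -prime_coprime.
have u0 : 0 < u by move: m0; rewrite Em muln_gt0 => /andP[].
have E1 : tau m = (logn p m).+1 * tau u by rewrite -(tau_prime_power _ pp u0 nd) mulnC -Em.
have E2 : tau (p * m) = (logn p m).+2 * tau u.
  by rewrite -(tau_prime_power _ pp u0 nd) expnS -mulnA [_ * u]mulnC -Em.
by rewrite E1 E2; lia.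
Qed.

Lemma prod_primes_gt0 (s : seq nat) : all prime s -> 0 < \prod_(p <- s) p.
Proof.
elim: s => [|p s IH]; rewrite ?big_nil // big_cons /= => /andP[pp /IH].
by move=> s0; rewrite muln_gt0 prime_gt0 ?s0.
Qed.

(** If every prime [p] of the list occurs in [m] at least about [n %/ p] times,
    multiplying [m] by the list increases the number of divisors at most by the
    factor [\prod (1 + p / n) <= 1 / (1 - \sum p / n)]. *)
Lemma tau_mul_primes n (s : seq nat) m : 0 < n -> 0 < m -> all prime s ->
  {in s, forall p, n <= p * (logn p m).+1} ->
  tau (\prod_(p <- s) p * m) * (n - sumn s) <= n * tau m.
Proof.
move=> n0 m0; elim: s => [|q s IH]; first by rewrite big_nil mul1n subn0 mulnC.
rewrite /= => /andP[pq ps] le.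
have {}IH : tau (\prod_(p <- s) p * m) * (n - sumn s) <= n * tau m.
  by apply: IH => // p pin; apply: le; rewrite inE pin orbT.
rewrite big_cons -mulnA; set M := \prod_(p <- s) p * m in IH *.
have M0 : 0 < M by rewrite muln_gt0 prod_primes_gt0.
have step : n * tau (q * M) <= (n + q) * tau M.
  have := tau_mul_prime pq M0.
  have : n <= q * (logn q M).+1.
    apply: leq_trans (le q (mem_head _ _)) _; rewrite leq_mul2l ltnS.
    by rewrite /M lognM ?prod_primes_gt0 // leq_addl orbT.
  move: (logn q M) => v nv E; rewrite -(@leq_pmul2r v.+1) // -mulnA E.
  by move: (tau M) => t; nia.
have [big|small] := leqP n (q + sumn s); first by rewrite (eqP big) muln0.
have lt : q + sumn s <= n := ltnW small.
move: step IH; set a := tau _; set b := tau M; set c := tau m; set S := sumn s in lt small *.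
move=> step IH.
rewrite -(@leq_pmul2l n) //.
have h1 : n * (a * (n - (q + S))) <= (n + q) * b * (n - (q + S)).
  by rewrite mulnA leq_mul2r step orbT.
have h2 : (n + q) * b * (n - (q + S)) <= n * (b * (n - S)).
  have [u Eu] : exists u, n = u + (q + S) by exists (n - (q + S)); lia.
  rewrite Eu addnK (_ : u + (q + S) - S = u + q); last by lia.
  by nia.
by apply: leq_trans h1 (leq_trans h2 _); rewrite leq_pmul2l.
Qed.

(** The prime factors of [r], with multiplicities; as both factors of a product
    are at least 2, their sum does not exceed the product. *)
Lemma prime_list r : 0 < r -> exists s, [/\ all prime s, \prod_(p <- s) p = r & sumn s <= r].
Proof.
have [m] := ubnP r; elim: m r => // m IH r /ltnSE le r0.
have [r1|r1] := leqP r 1; first by exists [::]; rewrite big_nil; split=> //; lia.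
have [q Eq] := dvdnP (pdiv_dvd r); have pp := pdiv_prime r1; have p1 := prime_gt1 pp.
have q0 : 0 < q by case: q Eq => // E; rewrite E in r1.
have [|s [ps Es ls]] := IH q _ q0; first by nia.
exists (pdiv r :: s); split; first by rewrite /= pp.
  by rewrite big_cons Es mulnC -Eq.
rewrite /=; have [q1|q1] := leqP q 1; last by move: p1 Eq; move: (pdiv r) => p; nia.
have Eq1 : q = 1 by lia.
case: s ps Es {ls} => [|x s]; first by rewrite /= addn0 pdiv_leq.
rewrite /= big_cons Eq1 => /andP[px ps] /eqP; rewrite muln_eq1 => /andP[/eqP x1 _].
by rewrite x1 in px.
Qed.

Lemma logn_fact_pred p r : prime p -> 0 < r -> p * r <= p * (logn p (p * r).-1`!).+1.
Proof.
move=> pp r0; rewrite leq_mul2l; apply/orP; right; have p1 := prime_gt1 pp.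
have [r1|r1] := leqP r 1; first by lia.
rewrite logn_fact // big_ltn ?expn1; last by nia.
have : r.-1 <= (p * r).-1 %/ p by rewrite leq_divRL ?prime_gt0 //; nia.
by lia.
Qed.

Lemma tau_fact_step n : 0 < n -> n`! = n * n.-1`!.
Proof. by case: n. Qed.

Lemma tau_fact_prime p : prime p -> tau p`! <= 2 * tau p.-1`!.
Proof.
move=> pp; rewrite tau_fact_step ?prime_gt0 //.
have := tau_mul_prime pp (fact_gt0 p.-1); move: (logn _ _) => v E.
rewrite -(@leq_pmul2r v.+1) // E; nia.
Qed.

(** Write [n = q * r] with [q] the largest prime factor.  For odd [q] the number
    of divisors is multiplied by at most [(1 + 1 / r) / (1 - 1 / q)], where [1 + 1 / r]
    accounts for [q] and the rest for the prime factors of [r], whose sum is at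
    most [r].  For [q = 2] and [n = 2 ^ a] the factor is at most
    [1 / (1 - 2 * a / n)]. *)
Lemma tau_fact_composite n : 25 < n -> ~~ prime n -> 8 * tau n`! <= 15 * tau n.-1`!.
Proof.
move=> n25 npn; have n0 : 0 < n by lia.
have f0 := fact_gt0 n.-1; have n1 : 1 < n by lia.
have pq := max_pdiv_prime n1; have [r Er] := dvdnP (max_pdiv_dvd n).
set q := max_pdiv n in pq Er; have q1 := prime_gt1 pq.
rewrite mulnC in Er.
have r1 : 1 < r.
  case: r Er => [|[|//]]; first by rewrite muln0 => E; rewrite E in n0.
  by rewrite muln1 => E; rewrite E pq in npn.
have lgn p : prime p -> p %| n -> n <= p * (logn p n.-1`!).+1.
  move=> pp /dvdnP[k Ek]; rewrite mulnC in Ek.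
  by rewrite Ek; apply: logn_fact_pred => //; case: k Ek => //; rewrite muln0; lia.
rewrite tau_fact_step //.
have [q2|q2] := eqVneq q 2.
  have [a Ea] : exists a, n = 2 ^ a.
    have : 2.-nat n.
      apply/pnatP => // p pp dp; rewrite !inE eqn_leq prime_gt1 // andbT -q2.
      by apply: max_pdiv_max; rewrite mem_primes pp n0.
    by move/part_pnat_id; rewrite p_part => <-; exists (logn 2 n).
  have p2 : all prime (nseq a 2) by rewrite all_nseq orbT.
  have le2 : {in nseq a 2, forall p, n <= p * (logn p n.-1`!).+1}.
    move=> p; rewrite mem_nseq => /andP[_ /eqP->]; apply: lgn => //.
    by rewrite -q2 max_pdiv_dvd.
  have := tau_mul_primes n0 f0 p2 le2.
  have -> : \prod_(p <- nseq a 2) p = n.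
    by rewrite Ea; elim: a {Ea p2 le2} => [|a IH]; rewrite ?big_nil // big_cons IH expnS.
  rewrite sumn_nseq => le.
  have a30 : 30 * a <= 7 * n.
    have a5 : 4 < a by rewrite -(ltn_exp2l 4 a (isT : 1 < 2)) -Ea; lia.
    rewrite Ea -(subnKC a5); elim: (a - 5) => // b; rewrite !addnS expnS; lia.
  rewrite -(@leq_pmul2l n) //; set t := tau (n * _) in le *; set u := tau n.-1`! in le *.
  apply: (@leq_trans (15 * (t * (n - 2 * a)))); last by lia.
  rewrite (_ : n * (8 * t) = t * (8 * n)); last by lia.
  rewrite (_ : 15 * _ = t * (15 * (n - 2 * a))); last by lia.
  by rewrite leq_mul2l; apply/orP; right; lia.
have q3 : 2 < q by rewrite ltn_neqAle eq_sym q2.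
have r0 : 0 < r by lia.
have [s [ps Es ls]] := prime_list r0.
have les : {in s, forall p, n <= p * (logn p n.-1`!).+1}.
  move=> p pin; apply: lgn; first exact: (allP ps).
  by rewrite Er -Es dvdn_mull // (big_rem p) //= dvdn_mulr.
have Es1 := tau_mul_primes n0 f0 ps les; rewrite Es in Es1.
have rM0 : 0 < r * n.-1`! by rewrite muln_gt0 r0.
have Eq := tau_mul_prime pq rM0.
have lv : n <= q * (logn q (r * n.-1`!)).+1.
  apply: leq_trans (lgn q pq (max_pdiv_dvd n)) _; rewrite leq_mul2l ltnS.
  by rewrite lognM // leq_addl orbT.
have -> : n * n.-1`! = q * (r * n.-1`!) by rewrite mulnA -Er.
set t1 := tau (r * _) in Es1 Eq *; set t2 := tau n.-1`! in Es1 Eq *.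
set t3 := tau (q * _) in Eq *; move: (logn _ _) Eq lv => v Eq lv.
have h1 : q.-1 * t1 <= q * t2.
  rewrite -(@leq_pmul2l r) // (_ : r * (q * t2) = n * t2); last by rewrite Er; lia.
  apply: leq_trans Es1; rewrite (_ : r * (q.-1 * t1) = t1 * (n - r)); last by rewrite Er; nia.
  by rewrite leq_mul2l; apply/orP; right; lia.
have h2 : r * t3 <= r.+1 * t1.
  rewrite -(@leq_pmul2r v.+1) // -mulnA Eq.
  have rv : r <= v.+1 by move: lv; rewrite Er leq_pmul2l ?prime_gt0.
  by nia.
have h3 : 8 * (r.+1 * q) <= 15 * (r * q.-1).
  have [q5|q5] := leqP 5 q; first by nia.
  have [q3'|q4] : q = 3 \/ q = 4 by lia.
    by move: Er; rewrite q3'; lia.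
  by move: pq; rewrite q4.
have rq0 : 0 < r * q.-1 by rewrite muln_gt0 r0; lia.
rewrite -(@leq_pmul2l (r * q.-1)) //.
have h4 : (r * q.-1) * t3 <= (r.+1 * q) * t2.
  rewrite (_ : r * q.-1 * t3 = q.-1 * (r * t3)); last by lia.
  apply: leq_trans (leq_mul (leqnn q.-1) h2) _.
  rewrite (_ : q.-1 * (r.+1 * t1) = r.+1 * (q.-1 * t1)); last by lia.
  by rewrite -mulnA leq_mul2l h1 orbT.
apply: (@leq_trans (8 * (r.+1 * q) * t2)); first by lia.
rewrite (_ : r * q.-1 * (15 * t2) = 15 * (r * q.-1) * t2); last by lia.
by rewrite leq_mul2r h3 orbT.
Qed.

Lemma tau_fact_double n : 25 < n -> tau n`! <= 2 * tau n.-1`!.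
Proof.
move=> n25; have [/tau_fact_prime //|np] := boolP (prime n).
by have := tau_fact_composite n25 np; lia.
Qed.

Lemma tau_le_facs f : all (fun pe => prime pe.1) f -> 0 < N.to_nat (valN f) ->
  (N.of_nat (tau (N.to_nat (valN f))) <= N.of_nat (size (divisorsN f)))%num.
Proof.
move=> pf v0; suff : tau (N.to_nat (valN f)) <= size (divisorsN f) by lia.
rewrite /tau -(size_map N.of_nat); apply: uniq_leq_size.
  by rewrite map_inj_uniq ?divisors_uniq //; apply: Nnat.Nat2N.inj.
by move=> x /mapP[d dd ->]; apply: valN_divisors; rewrite // -dvdn_divisors in dd.
Qed.

(** From [n] to [n + 2], one of the two new factors being even, the number of
    divisors grows at most by the factor [15 / 4], and the central binomial
    coefficient at least by this factor.  The constant [11 / 200] is adjusted to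
    [n = 26] and [n = 27]. *)
Lemma tau_fact_central n : 25 < n ->
  200 * tau n`! * (n./2`! * (uphalf n)`!) <= 11 * n`!.
Proof.
have base m : m \in [:: 26; 27] -> 200 * tau m`! * (m./2`! * (uphalf m)`!) <= 11 * m`!.
  move=> mm; have c : (check_facs 1 m && (200 * foldr (fun pe x => N.of_nat pe.2.+1 * x) 1
      (fact_facs 1 m) * (factN m./2 * factN (uphalf m)) <=? 11 * factN m))%num.
    by move: mm; rewrite !inE => /orP[] /eqP->; vm_compute.
  case/andP: c => /and3P[/N.eqb_eq E _ pf] /N.leb_spec0.
  have := tau_le_facs pf; rewrite size_divisorsN.
  have Ev : N.to_nat (valN (fact_facs (2 - 1) m)) = m`!.
    by rewrite -factN_nat -E; lia.
  rewrite Ev => /(_ (fact_gt0 m)).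
  move: (foldr _ _ _) => t h1 h2.
  have {}h1 : tau m`! <= N.to_nat t by lia.
  have {h2} : N.to_nat (200 * t * (factN m./2 * factN (uphalf m))) <= N.to_nat (11 * factN m) by lia.
  rewrite !Nnat.N2Nat.inj_mul !factN_nat; apply: leq_trans.
  by rewrite leq_mul2r leq_mul2l h1 !orbT.
have [k] := ubnP n; elim: k n => // k IH n /ltnSE le n25.
have [n28|n28] := leqP 28 n; last first.
  by apply: base; rewrite !inE; case: n n25 n28 {le} => // n; lia.
have [m Em] : exists m, n = m.+2 by exists (n - 2); lia.
have m25 : 25 < m by lia.
have {IH} IH := IH m _ m25; have {}IH := IH (ltac:(lia)).
have t2 : 4 * tau n`! <= 15 * tau m`!.
  have even_np j : 25 < j -> ~~ odd j -> ~~ prime j.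
    by move=> j25; apply: contra => /even_prime[E|//]; rewrite E in j25.
  have m1 : 25 < m.+1 by lia.
  have := tau_fact_double m1; have := tau_fact_double n25; rewrite Em /= => d1 d2.
  have [o|e] := boolP (odd m).
    have e1 : ~~ odd m.+1 by rewrite /= o.
    by have /= := tau_fact_composite m1 (even_np _ m1 e1); lia.
  have e2 : ~~ odd n by rewrite Em /= negbK.
  by have := tau_fact_composite n25 (even_np _ n25 e2); rewrite Em /=; lia.
have Eh : n./2 = m./2.+1 by rewrite Em.
have Eu : uphalf n = (uphalf m).+1 by rewrite Em.
rewrite Eh Eu [in n`!]Em !factS in t2 *.
have hu : m./2 + uphalf m = m by rewrite addnC; lia.
have key : 15 * (m./2.+1 * (uphalf m).+1) <= 4 * (m.+2 * m.+1).
  rewrite -(@leq_pmul2l 4) // mulnCA.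
  apply: leq_trans (leq_mul (leqnn 15) (nat_AGM2 _ _).1) _.
  rewrite (_ : m./2.+1 + (uphalf m).+1 = m.+2); last by lia.
  rewrite -mulnn (_ : 4 * _ = m.+2 * (16 * m.+1)); last by lia.
  by rewrite mulnCA leq_mul2l; lia.
rewrite -(@leq_pmul2l 4) //.
set X := m./2`! in IH *; set Y := (uphalf m)`! in IH *; set a := m./2.+1 in key *.
set b := (uphalf m).+1 in key *.
apply: (@leq_trans (15 * (a * b) * (200 * tau m`! * (X * Y)))).
  rewrite (_ : 4 * _ = a * b * (200 * (X * Y)) * (4 * tau (m.+2 * (m.+1 * m`!)))); last by lia.
  rewrite (_ : 15 * (a * b) * _ = a * b * (200 * (X * Y)) * (15 * tau m`!)); last by lia.
  by rewrite leq_mul2l t2 orbT.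
apply: leq_trans (leq_mul key IH) _; lia.
Qed.

(** * Groups of large degree *)

Lemma bin_half_ge m r : r * 2 <= m -> 2 ^ r <= 'C(m, r).
Proof.
elim: r m => [|r IH] m; first by rewrite bin0.
case: m => // m le; have {IH} IH := IH m (ltac:(lia)).
rewrite expnS -(@leq_pmul2l r.+1) // -mul_bin_diag.
apply: leq_trans (leq_mul (_ : r.+1 * 2 <= m.+1) IH); lia.
Qed.

Lemma bin_pred_ge m e : 2 < e -> e * 2 <= m -> 2 ^ e <= 'C(m.-1, e.-1).
Proof.
case: e => [|[|[|e]]] // _; elim: e m => [|e IH] m le.
  case: m le => [|[|m]] // le; rewrite /= bin2 -divn2 leq_divRL //=; nia.
case: m le => [|[|m]] // le; have {IH} IH : 2 ^ e.+3 <= 'C(m, e.+2) by apply: (IH m.+1); lia.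
rewrite expnS -(@leq_pmul2l e.+3) //= -mul_bin_diag.
apply: leq_trans (leq_mul (_ : e.+3 * 2 <= m.+1) IH); lia.
Qed.

Lemma bin_classes t m e : 0 < e -> t * e <= m -> t * 'C(m.-1, e.-1) <= 'C(m, e).
Proof.
case: e => // e _; case: m => [|m] le; first by have -> : t = 0 by lia.
by rewrite -(@leq_pmul2l e.+1) // -mul_bin_diag /= mulnA leq_mul2r [e.+1 * t]mulnC le orbT.
Qed.

Lemma fact_uphalf_ge m : 2 ^ m <= 16 * (uphalf m)`!.
Proof.
have [k] := ubnP m; elim: k m => // k IH [|[|m]] /ltnSE le //.
have [m8|m8] := leqP 7 m; last by case: m le m8 => [|[|[|[|[|[|[|m]]]]]]].
have := IH m (ltac:(lia)); rewrite /= factS !expnS; nia.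
Qed.

Section WeakBound.

Variable T : finType.
Implicit Types (a b : T) (S D E : {set T}).
Implicit Types G H K : {group {perm T}}.

Lemma max_cls G : cyc3_free G \/
  exists a, 2 < #|cls G a| /\ forall b, #|cls G b| <= #|cls G a|.
Proof.
have [/forallP le2|/forallPn[a0]] := boolP [forall a, #|cls G a| <= 2].
  by left; apply: cls_le2_free.
rewrite -ltnNge => gt2; right.
have [a _ maxa] := @arg_maxnP _ a0 xpredT (fun a => #|cls G a|) isT.
by exists a; split=> [|b]; [apply: leq_trans gt2 _; apply: maxa | apply: maxa].
Qed.

Lemma cls_away_le G S a d : G \subset perm.Sym S -> 0 < d -> (forall b, #|cls G b| <= d) ->
  forall b, #|cls (away G S (cls G a)) b| <= d.
Proof.
move=> sGS d0 le b; have [bS|bS] := boolP (b \in S :\: cls G a).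
  by rewrite cls_away.
by rewrite (cls_out (away_sub _ _ _) bS).
Qed.

(** Groups whose classes have at most [d] points have an index growing like a
    power of 2.  To strip a class of size [e <= #|S| / 2], when there are [t] classes
    of this size, one uses [t * e`! * (#|S| - e)`! <= #|S|`! / 2 ^ e]; a larger class
    is unique, and [#|S|`! / (e`! * (#|S| - e)`!)] is already large enough. *)
Lemma weak_class_bound d G S : G \subset perm.Sym S -> 3 < d -> d <= #|S| ->
  (forall b, #|cls G b| <= d) -> #|G| * 2 ^ (#|S| - d) <= #|S|`!.
Proof.
move=> + d3; have [k] := ubnP #|S|; elim: k G S => // k IH G S /ltnSE lek sGS dS le.
case: (max_cls G) => [free|[a [e2 maxe]]].
  apply: leq_trans (cyc3_free_bound sGS free); rewrite leq_mul2l; apply/orP; right.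
  have := fact_uphalf_ge #|S|; rewrite -{1}(subnK (leq_trans d3 dS)) expnD.
  have : 2 ^ (#|S| - d) <= 2 ^ (#|S| - 4) by rewrite leq_exp2l //; lia.
  rewrite -[2 ^ 4]/16; lia.
have aS : a \in S.
  by apply: contraTT e2 => /(cls_out sGS) ->.
set e := #|cls G a| in e2 maxe; pose t := #|classes_of_size G S e|.
have te : t * e <= #|S| by apply: card_classes_of_size.
have leG : #|G| <= t * e`! * #|away G S (cls G a)| by apply: card_away.
have sK := away_sub G S (cls G a).
have cS : #|S :\: cls G a| = #|S| - e by rewrite cardsD (setIidPr (cls_sub sGS aS)).
have ed : e <= d := le a.
have leK : #|away G S (cls G a)| <= (#|S| - e)`!.
  by rewrite -cS -perm.card_Sym subset_leq_card.
have eS : e <= #|S| by lia.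
have big2 : e * 2 <= #|S| -> t * 2 ^ e <= 'C(#|S|, e).
  move=> e2S; apply: leq_trans (bin_classes (ltnW (ltnW e2)) te).
  by rewrite leq_mul2l bin_pred_ge ?orbT.
suff [x [xd lx hx]] : exists x, [/\ x <= #|S| - d, t * 2 ^ (#|S| - d - x) <= 'C(#|S|, e) &
    #|away G S (cls G a)| * 2 ^ x <= (#|S| - e)`!].
  rewrite -(bin_fact eS) -(subnK xd) expnD.
  apply: leq_trans (leq_mul leG (leqnn _)) _.
  set K := #|_|; rewrite (_ : _ * _ * K * _ = t * 2 ^ (#|S| - d - x) * (e`! * (K * 2 ^ x))); last by lia.
  by apply: leq_mul => //; rewrite leq_mul2l hx orbT.
have [small|big] := ltnP (#|S| - e) d; last first.
  exists (#|S| - d - e); split; first by lia.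
    have -> : #|S| - d - (#|S| - d - e) = e by lia.
    by apply: big2; lia.
  have := IH _ (S :\: cls G a) _ sK; rewrite cS => H.
  have -> : #|S| - d - e = #|S| - e - d by lia.
  by apply: H => //; [lia | apply: cls_away_le; rewrite ?(ltnW (ltnW (ltnW d3)))].
exists 0; split=> //; last by rewrite muln1.
rewrite subn0; have [e2S|e2S] := leqP (e * 2) #|S|.
  apply: leq_trans (big2 e2S); rewrite leq_mul2l leq_exp2l //; lia.
have t1 : t <= 1 by move: te e2S; nia.
rewrite -bin_sub //; apply: leq_trans (bin_half_ge _); last by lia.
rewrite -[X in _ <= X]mul1n leq_mul // leq_exp2l //; lia.
Qed.

End WeakBound.

(** The function [e |-> 'C(n.-1, e.-1) * 2 ^ (n - 2 * e)] increases up to about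
    [n / 5] and decreases from there on, so that on an interval it is bounded
    below by its values at both ends. *)
Lemma bin_unimodal n e : 25 < n -> 3 < e -> e * 2 <= n ->
  'C(n, n./2) <= 2 * ('C(n.-1, e.-1) * 2 ^ (n - e * 2)).
Proof.
move=> n25 e3 en; have [low|high] := leqP (5 * e.-1) n.
  have up k : 5 * (k + 3) <= n -> 'C(n.-1, 3) * 4 ^ k <= 'C(n.-1, k + 3).
    elim: k => [|k IH] le; first by rewrite muln1.
    have {IH} IH := IH (ltac:(lia)).
    have st := mul_bin_left n.-1 (k + 3).
    rewrite -(@leq_pmul2l (k + 3).+1) // addSn st expnS.
    have h : 4 * (k + 3).+1 <= n.-1 - (k + 3) by lia.
    apply: leq_trans (leq_mul h IH); lia.
  have := up (e - 4); rewrite (_ : e - 4 + 3 = e.-1); last by lia.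
  move=> /(_ low).
  have c3 : 128 <= 'C(n.-1, 3).
    apply: leq_trans (_ : 'C(25, 3) <= _); first by [].
    by apply: leq_bin2l; lia.
  have n2 : 'C(n, n./2) <= 2 ^ n.
    rewrite -[2]/(1 + 1) expnDn (bigD1 (inord n./2)) //= inordK; last by lia.
    by rewrite !exp1n !muln1 leq_addr.
  move=> h; apply: leq_trans n2 _.
  have E : 2 ^ n = 128 * 4 ^ (e - 4) * 2 * 2 ^ (n - e * 2).
    have E4 : 4 ^ (e - 4) = 2 ^ (2 * (e - 4)) by rewrite expnM.
    by rewrite E4 -[128]/(2 ^ 7) -expnD -expnSr -expnD; congr (2 ^ _); lia.
  rewrite E; have h' : 128 * 4 ^ (e - 4) <= 'C(n.-1, e.-1).
    by apply: leq_trans h; rewrite leq_mul2r c3 orbT.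
  rewrite mulnA [2 * 'C(_, _)]mulnC.
  by rewrite !leq_mul2r h' !orbT.
have down k : k < n./2 -> n <= 5 * (n./2 - k) ->
    'C(n, n./2) <= 2 * ('C(n.-1, (n./2 - k).-1) * 2 ^ (n - (n./2 - k) * 2)).
  elim: k => [|k IH] lk le.
    rewrite subn0; have [h Eh] : exists h, n./2 = h.+1 by exists (n./2).-1; lia.
    have [m Em] : exists m, n = m.+1 by exists n.-1; lia.
    rewrite Eh -(@leq_pmul2l h.+1) // [in 'C(n, _)]Em -mul_bin_diag Em /=.
    have := odd_double_half n; rewrite Eh Em -muln2 => Eo.
    have [Ed|Ed] : m.+1 - h.+1 * 2 = 0 \/ m.+1 - h.+1 * 2 = 1.
      by move: Eo; case: (odd _); lia.
      rewrite Ed muln1 mulnA leq_mul2r; apply/orP; right.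
      by move: Eo; case: (odd _); lia.
    rewrite Ed (_ : h.+1 * _ = (h.+1 * 4) * 'C(m, h)); last by lia.
    rewrite leq_mul2r; apply/orP; right; move: Eo; case: (odd _); lia.
  have {IH} IH := IH (ltac:(lia)) (ltac:(lia)).
  apply: leq_trans IH _; rewrite leq_mul2l /=.
  have [j Ej] : exists j, n./2 - k = j.+2 by exists (n./2 - k - 2); lia.
  have -> : n./2 - k.+1 = j.+1 by lia.
  rewrite Ej /= (_ : n - j.+1 * 2 = (n - j.+2 * 2) + 2) ?expnD; last by lia.
  rewrite [2 ^ _ * 2 ^ 2]mulnC mulnA leq_mul2r; apply/orP; right; rewrite -[2 ^ 2]/4.
  rewrite -(@leq_pmul2l j.+1) // mul_bin_left.
  rewrite [_ * 4]mulnC mulnA leq_mul2r; apply/orP; right; lia.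
have := down (n./2 - e); rewrite subKn; last by lia.
by apply; lia.
Qed.

Lemma bin_le_pow n k : 'C(n, k) <= 2 ^ n.
Proof.
elim: n k => [|n IH] [|k] //; first by rewrite bin0 expn_gt0.
by rewrite binS expnS mul2n -addnn leq_add.
Qed.

Lemma pow4_le_fact u : 12 < u -> 4 ^ u <= u`!.
Proof.
have h v : 3 < v -> 4 ^ v <= 11 * v`!.
  elim: v => // v IH; rewrite leq_eqVlt => /orP[/eqP [<-] //|v3].
  have {IH} := IH v3; rewrite expnS factS; move: (4 ^ v) (v`!) => x y; nia.
move=> u12; have [v Ev] : exists v, u = v.+3 by exists (u - 3); lia.
have v3 : 3 < v by lia.
rewrite Ev !expnS !factS; have := h v v3; have : 704 <= v.+3 * (v.+2 * v.+1) by nia.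
move: (4 ^ v) (v`!) => x y; nia.
Qed.

Section Nongiant.

Variable T : finType.
Implicit Types G H K : {group {perm T}}.

(** If a class of maximal size [e] has at most half of the points, stripping it
    and bounding the rest by [weak_class_bound] shows that the index of [G] is at
    least ['C(n.-1, e.-1) * 2 ^ (n - 2 * e)] (for [e > 3]), hence at least half the
    central binomial coefficient by [bin_unimodal]. *)
Lemma giant_or_small (c : nat) G : within c G -> 25 < #|T| ->
  (exists k, [/\ #|T| < k * 2, k <= #|T|, k`! %| 2 * #|G|
     & c * #|G| %| k`! * (#|T| - k)`!])
  \/ #|G| <= 2 * ((#|T|./2)`! * (uphalf #|T|)`!).
Proof.
move=> cG n25; set n := #|T| in n25 *.
have hn : n./2 <= n by lia.
have un : n - n./2 = uphalf n by rewrite uphalf_half; have := odd_double_half n; rewrite -addnn; lia.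
have Cn := bin_fact hn; rewrite un in Cn.
have fin : #|G| * 'C(n, n./2) <= 2 * n`! -> #|G| <= 2 * ((n./2)`! * (uphalf n)`!).
  rewrite -Cn mulnCA [#|G| * _]mulnC leq_pmul2l // bin_gt0 //.
have sGT := cardS_Sym G.
case: (class_trichotomy cG) => [free|[k [? ? ? ? ?]]|]; last 2 first.
- by left; exists k.
- case=> [e [m [j [[e2 en _ _] _ _ _ [a Ea maxa]]]]]; right; apply: fin.
  pose t := #|classes_of_size G [set: T] e|; pose K := away G [set: T] (cls G a).
  have te : t * e <= n by rewrite /n -cardsT; apply: card_classes_of_size.
  have leG : #|G| <= t * e`! * #|K| by rewrite /t -Ea; apply: card_away.
  have cS : #|[set: T] :\: cls G a| = n - e by rewrite cardsD setTI cardsT Ea.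
  pose d := maxn e 4.
  have d3 : 3 < d by rewrite /d; lia.
  have leK : #|K| * 2 ^ (n - e - d) <= (n - e)`!.
    rewrite -cS; apply: weak_class_bound; rewrite ?away_sub ?cS //; first by rewrite /d; lia.
    apply: cls_away_le => // [|b]; first by lia.
    by apply: leq_trans (maxa b) _; rewrite /d; lia.
  have t0 : 0 < t by apply/card_gt0P; exists (cls G a); apply/classes_of_sizeP; exists a.
  have binB : 'C(n, n./2) <= 2 * ('C(n.-1, e.-1) * 2 ^ (n - e - d)).
    have [e3|e3] := leqP 4 e.
      have := bin_unimodal n25 e3 en; rewrite /d (maxn_idPl e3).
      by rewrite (_ : n - e - e = n - e * 2) //; lia.
    have {e3} e3 : e = 3 by lia.
    apply: leq_trans (bin_le_pow _ _) _; rewrite /d e3 /=.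
    have c2 : 64 <= 'C(n.-1, 2) by apply: (@leq_trans 'C(25, 2)) => //; apply: leq_bin2l; lia.
    have -> : 2 ^ n = 2 * (64 * 2 ^ (n - 3 - 4)).
      by rewrite -[64]/(2 ^ 6) -expnD -expnS; congr (2 ^ _); lia.
    by rewrite leq_mul2l leq_mul2r c2 !orbT.
  have eS : e <= n by lia.
  have h1 : #|G| * 'C(n.-1, e.-1) * 2 ^ (n - e - d) <= n`!.
    rewrite -(@leq_pmul2l t) // -(bin_fact eS).
    have h := bin_classes (ltnW (ltnW e2)) te.
    apply: (@leq_trans (t * e`! * #|K| * 'C(n, e) * 2 ^ (n - e - d))).
      rewrite mulnA mulnCA leq_mul2r; apply/orP; right.
      by apply: leq_mul.
    rewrite (_ : t * e`! * #|K| * 'C(n, e) * _ = t * 'C(n, e) * e`! * (#|K| * 2 ^ (n - e - d))); last by lia.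
    rewrite (_ : t * ('C(n, e) * (e`! * (n - e)`!)) = t * 'C(n, e) * e`! * (n - e)`!); last by lia.
    by rewrite leq_mul2l leK orbT.
  apply: leq_trans (leq_mul (leqnn #|G|) binB) _.
  by rewrite mulnCA leq_mul2l mulnA h1 orbT.
right; apply: fin; have := cyc3_free_bound sGT free; rewrite cardsT -/n => h.
have u0 := fact_gt0 (uphalf n).
rewrite -(@leq_pmul2r (uphalf n)`!) // mulnAC.
apply: leq_trans (leq_mul h (leqnn _)) _.
rewrite [2 * _]mulnC -mulnA leq_mul2l; apply/orP; right.
apply: leq_trans (bin_le_pow _ _) _.
have := @pow4_le_fact (uphalf n) (ltac:(lia)).
have : 2 ^ n <= 4 ^ uphalf n by rewrite -[4]/(2 ^ 2) -expnM leq_exp2l //; lia.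
by lia.
Qed.

End Nongiant.

(** * The sum of the orders in large degree *)

Definition check_tau (r : nat) : bool :=
  [&& (valN (fact_facs 1 r) =? factN r)%num, all (fun pe => prime pe.1) (fact_facs 1 r)
    & (foldr (fun pe x => N.of_nat pe.2.+1 * x) 1 (fact_facs 1 r) <=? 2 ^ N.of_nat r.-1)%num].

(** For [r > 25] the number of divisors at most doubles from [r.-1`!] to [r`!]. *)
Lemma tau_fact_pow r : 0 < r -> tau r`! <= 2 ^ r.-1.
Proof.
elim: r => // r IH _; have [r25|r25] := leqP r.+1 25; last first.
  have := tau_fact_double r25; rewrite /=; have := IH (ltac:(lia)).
  by case: r r25 {IH} => // r _; rewrite /= expnS; lia.
have /allP h : all check_tau (iota 1 25) by vm_compute.
have /and3P[/N.eqb_eq E pf /N.leb_spec0] := h r.+1 (ltac:(rewrite mem_iota; lia)).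
have := tau_le_facs pf; rewrite size_divisorsN E factN_nat => /(_ (fact_gt0 _)) h1 h2.
have {h1 h2} h3 := N.le_trans _ _ _ h1 h2.
by rewrite -(N_pow 2 r) /=; move: h3; rewrite [r.+1.-1]/=; lia.
Qed.

Lemma bin_shift n r : 3 < r -> r * 2 <= n -> 2 ^ (r - 4) * 'C(n - r + 4, 4) <= 'C(n, r).
Proof.
elim: r n => // r IH n; rewrite leq_eqVlt => /orP[/eqP <-|r3] le.
  by rewrite subnn mul1n subnK //; lia.
case: n le => // n le; have {IH} IH := IH n r3 (ltac:(lia)).
rewrite -(@leq_pmul2l r.+1) // -mul_bin_diag (_ : r.+1 - 4 = (r - 4).+1); last by lia.
rewrite subSS expnS; apply: leq_trans (leq_mul (_ : r.+1 * 2 <= n.+1) IH); lia.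
Qed.

Lemma bin4_ge h : 12 < h -> 160 * (h - 3) <= 'C(h + 4, 4).
Proof.
move=> h12; rewrite -(@leq_pmul2r 4`!) // bin_ffact.
have -> : (h + 4) ^_ 4 = (h + 4) * ((h + 3) * ((h + 2) * (h + 1))).
  by rewrite !ffactnS ffactn0 muln1 !addn4 !addnS addn0.
rewrite -[4`!]/24; have : 3840 * (h - 3) <= (h + 4) * ((h + 3) * ((h + 2) * (h + 1))).
  have : 16 * 16 * 15 <= (h + 4) * (h + 3) * (h + 2).
    by apply: leq_mul; [apply: leq_mul|]; lia.
  rewrite -[16 * 16 * 15]/3840 => h1; rewrite !mulnA.
  by apply: leq_mul; lia.
lia.
Qed.

(** The orders of the groups with a class of [n - r] points contribute at most
    [2 ^ r / 'C(n, r)] relative to [n`!].  The terms with [r < 4] are at most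
    [1 / 10] in total; in the others ['C(n, r)] exceeds [2 ^ r] by a polynomial of
    degree 4 in [n]. *)
Lemma giant_terms n : 25 < n ->
  5 * \sum_(1 <= r < n./2.+1) 2 ^ r * (r`! * (n - r)`!) <= n`!.
Proof.
move=> n25; have h12 : 12 < n./2 by lia.
rewrite (big_cat_nat (n := 4)) //=; last by lia.
set A := \sum_(1 <= r < 4) _; set B := \sum_(4 <= r < _) _.
have hA : 10 * A <= n`!.
  have [m Em] : exists m, n = m.+3 by exists (n - 3); lia.
  rewrite /A big_ltn // big_ltn // big_ltn // big_geq // addn0.
  have -> : (n - 1)`! = m.+2 * (m.+1 * m`!) by rewrite Em subn1 /= !factS.
  have -> : (n - 2)`! = m.+1 * m`! by rewrite Em subn2 /= !factS.
  have -> : (n - 3)`! = m`! by rewrite Em -addn3 addnK.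
  have -> : n`! = m.+3 * (m.+2 * (m.+1 * m`!)) by rewrite Em !factS.
  rewrite -[1`!]/1 -[2`!]/2 -[3`!]/6 -[2 ^ 1]/2 -[2 ^ 2]/4 -[2 ^ 3]/8.
  have h : 10 * (2 * (m.+2 * m.+1) + 8 * m.+1 + 48) <= m.+3 * (m.+2 * m.+1).
    have m23 : 23 <= m by lia.
    have h1 : 26 * (m.+2 * m.+1) <= m.+3 * (m.+2 * m.+1) by apply: leq_mul => //; lia.
    have h2 : 25 * m.+1 <= m.+2 * m.+1 by apply: leq_mul => //; lia.
    by lia.
  by move: h (m`!) => h f; have := leq_mul h (leqnn f); lia.
have hB : 10 * B <= n`!.
  have hBC : 'C(n./2 + 4, 4) * B <= 16 * (n./2 - 3) * n`!.
    rewrite /B big_distrr /=.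
    apply: leq_trans (_ : \sum_(4 <= r < n./2.+1) 16 * n`! <= _); last first.
      rewrite sum_nat_const_nat; have -> : n./2.+1 - 4 = n./2 - 3 by lia.
      by lia.
    rewrite big_nat_cond [X in _ <= X]big_nat_cond; apply: leq_sum => r.
    rewrite andbT => /andP[r4 rh].
    have rn : r <= n by lia.
    have b1 := @bin_shift n r r4 (ltac:(lia)).
    have b2 : 'C(n./2 + 4, 4) <= 'C(n - r + 4, 4) by apply: leq_bin2l; lia.
    rewrite -(bin_fact rn) (_ : 2 ^ r = 16 * 2 ^ (r - 4)); last first.
      by rewrite -[16]/(2 ^ 4) -expnD; congr (2 ^ _); lia.
    rewrite (_ : 'C(n./2 + 4, 4) * _ = 16 * (2 ^ (r - 4) * 'C(n./2 + 4, 4) * (r`! * (n - r)`!))); last by lia.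
    rewrite leq_mul2l leq_mul2r; apply/orP; right; apply/orP; right.
    by apply: leq_trans b1; rewrite leq_mul2l b2 orbT.
  have := bin4_ge h12 => b4.
  rewrite -(@leq_pmul2l (16 * (n./2 - 3))); last by lia.
  apply: leq_trans hBC; rewrite mulnA leq_mul2r; apply/orP; right; lia.
lia.
Qed.

Definition giant_order (c n r d : nat) : bool :=
  ((n - r)`! %| 2 * d) && (c * d %| r`! * (n - r)`!).

Lemma giant_order_ratio (c n r d : nat) : (c == 1) || (c == 2) -> giant_order c n r d ->
  exists2 i, i %| 2 * r`! %/ c & 2 * d = i * (n - r)`!.
Proof.
move=> c12 /andP[/dvdnP[i Ei] dv]; exists i => //.
have h : c * i %| 2 * r`!.
  rewrite -(@dvdn_pmul2r (n - r)`!) ?fact_gt0 // -mulnA -Ei mulnCA -mulnA.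
  by rewrite dvdn_pmul2l.
by rewrite dvdn_divRL //; [rewrite mulnC | case/orP: c12 => /eqP-> //; rewrite ?dvd1n ?dvdn_mulr].
Qed.

Lemma giant_order_sub (c n r : nat) s : (c == 1) || (c == 2) -> uniq s ->
  all (giant_order c n r) s -> exists L : seq nat, [/\ uniq L,
    {subset L <= divisors (2 * r`! %/ c)}, size L = size s
  & 2 * \sum_(d <- s) d = (\sum_(i <- L) i) * (n - r)`!].
Proof.
move=> c12 us al; exists [seq 2 * d %/ (n - r)`! | d <- s].
have E d : d \in s -> exists2 i, i %| 2 * r`! %/ c & 2 * d = i * (n - r)`!.
  by move=> ds; apply: giant_order_ratio => //; apply: (allP al).
have D0 : 0 < 2 * r`! %/ c.
  by case/orP: c12 => /eqP->; rewrite ?divn1 ?mulKn ?fact_gt0 // muln_gt0 fact_gt0.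
split.
- rewrite map_inj_in_uniq // => x y /E[i _ Ei] /E[j _ Ej].
  by rewrite Ei Ej !mulnK ?fact_gt0 // => ij; move: Ei Ej; rewrite ij; lia.
- move=> x /mapP[d /E[i di Ei] ->]; rewrite Ei mulnK ?fact_gt0 //.
  by rewrite -dvdn_divisors.
- by rewrite size_map.
rewrite big_map big_distrl big_distrr /=; apply: eq_big_seq => d /E[i _ Ei].
by rewrite Ei mulnK ?fact_gt0.
Qed.

(** For [r > 0] each of the at most [tau (2 * r`! %/ c)] orders is at most
    [r`! * (n - r)`! / c]. *)
Lemma giant_order_sum (c n r : nat) s : (c == 1) || (c == 2) -> uniq s -> 0 < r ->
  all (giant_order c n r) s -> c ^ 2 * \sum_(d <- s) d <= 2 ^ r * (r`! * (n - r)`!).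
Proof.
move=> c12 us r0 al; have [L [uL sL zL _]] := giant_order_sub c12 us al.
have zs : size s <= tau (2 * r`! %/ c) by rewrite -zL; apply: uniq_leq_size.
have leT : c * tau (2 * r`! %/ c) <= 2 ^ r.
  have E : 2 ^ r = 2 * 2 ^ r.-1 by rewrite -expnS prednK.
  have h := tau_fact_pow r0.
  case/orP: c12 => /eqP->; last by rewrite mulKn // E leq_mul2l h.
  rewrite divn1 mul1n E; apply: leq_trans (leq_mul (leqnn 2) h).
  have := tau_mul_prime (isT : prime 2) (fact_gt0 r); move: (logn _ _) => v Ev.
  by rewrite -(@leq_pmul2r v.+1) // Ev; nia.
have lem : {in s, forall d, c * d <= r`! * (n - r)`!}.
  move=> d /(allP al)/andP[_]; apply: dvdn_leq.
  by rewrite muln_gt0 !fact_gt0.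
have h : c * \sum_(d <- s) d <= size s * (r`! * (n - r)`!).
  rewrite -(size_map (muln c)) big_distrr /= -(big_map (muln c) xpredT id).
  by apply: sum_le_size => x /mapP[d ds ->]; apply: lem.
rewrite -mulnn -mulnA; apply: leq_trans (leq_mul (leqnn c) h) _.
rewrite mulnA leq_mul2r; apply/orP; right; apply: leq_trans leT.
by rewrite leq_mul2l zs orbT.
Qed.

Lemma whole_order_sum (c n : nat) s : (c == 1) || (c == 2) -> uniq s ->
  all (giant_order c n 0) s -> 2 * \sum_(d <- s) d <= (if c == 1 then 3 else 1) * n`!.
Proof.
move=> c12 us al; have [L [uL sL _ ->]] := giant_order_sub c12 us al.
rewrite subn0 leq_mul2r; apply/orP; right.
apply: leq_trans (sum_uniq_sub _ uL sL) _.
by case/orP: c12 => /eqP->; rewrite !unlock.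
Qed.

Section LargeDegree.

Variable T : finType.

(** Relative to [n`!] the sum is at most [3 / 2 + 1 / 5 + 11 / 100 < 2] for [c = 1]
    and at most [1 / 2 + 1 / 20 + 11 / 100 < 2 / 3] for [c = 2]. *)
Lemma large_degree_sum (c : nat) s : 25 < #|T| -> (c == 1) || (c == 2) -> uniq s ->
  orders_within T c s ->
  if c == 1 then \sum_(d <- s) d < 2 * #|T|`! else 6 * \sum_(d <- s) d < 4 * #|T|`!.
Proof.
set n := #|T| => n25 c12 us os.
pose M := 2 * ((n./2)`! * (uphalf n)`!); pose h := n./2.
have cases d : d \in s -> (d <= M) || has (fun r => giant_order c n r d) (iota 0 h.+1).
  case/os=> G cG ->; case: (giant_or_small cG n25) => [[k [k1 k2 d1 d2]]|le].
    apply/orP; right; apply/hasP; exists (n - k); first by rewrite mem_iota /h; lia.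
    by rewrite /giant_order subKn // d1 [_ * k`!]mulnC.
  by rewrite le.
have part : \sum_(d <- s) d <= \sum_(d <- s | d <= M) d +
    \sum_(r <- iota 0 h.+1) \sum_(d <- s | giant_order c n r d) d.
  rewrite (exchange_big_dep xpredT) //= [\sum_(d <- s | d <= M) d]big_mkcond.
  rewrite -big_split /= big_seq [X in _ <= X]big_seq.
  apply: leq_sum => d ds; case/orP: (cases d ds) => [->|/hasP[r rI gr]]; first exact: leq_addr.
  by rewrite (perm_big _ (perm_to_rem rI)) big_cons gr addnCA leq_addr.
have rest : 100 * \sum_(d <- s | d <= M) d <= 11 * n`!.
  rewrite -big_filter.
  have leM : {in [seq d <- s | d <= M], forall d, d <= M} by move=> d; rewrite mem_filter => /andP[].
  apply: leq_trans (leq_mul (leqnn 100) (sum_le_size leM)) _.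
  have sz : size [seq d <- s | d <= M] <= tau n`!.
    apply: uniq_leq_size; first exact: filter_uniq.
    move=> d; rewrite mem_filter => /andP[_ /os[G cG ->]].
    rewrite -dvdn_divisors ?fact_gt0 //; apply: dvdn_trans (within_dvd cG _); first exact: dvdn_mull.
    by rewrite -/n; lia.
  apply: leq_trans (tau_fact_central n25); move: (size _) sz => z sz.
  rewrite /M (_ : 100 * _ = 200 * z * ((n./2)`! * (uphalf n)`!)); last by lia.
  by rewrite leq_mul2r leq_mul2l sz !orbT.
have al r : all (giant_order c n r) [seq d <- s | giant_order c n r d] by apply: filter_all.
have := whole_order_sum c12 (filter_uniq _ us) (al 0); rewrite big_filter => whole.
have terms : 5 * (c ^ 2 * \sum_(r <- iota 1 h) \sum_(d <- s | giant_order c n r d) d) <= n`!.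
  apply: leq_trans (giant_terms n25); rewrite leq_mul2l /= big_distrr /=.
  rewrite /index_iota subn1 /= !big_seq; apply: leq_sum => r; rewrite mem_iota -big_filter => /andP[r1 _].
  exact: giant_order_sum (filter_uniq _ us) r1 (al r).
rewrite [iota 0 h.+1]/= big_cons in part; have f0 := fact_gt0 n.
move: part rest whole terms; set A := \sum_(d <- s | giant_order c n 0 d) d.
set B := \sum_(r <- iota 1 h) _; set C := \sum_(d <- s | d <= M) d.
case/orP: c12 => /eqP -> /=; lia.
Qed.

End LargeDegree.

(** * Orders of subgroups and the invariant [J] *)

Section Orders.

Variable gT : finGroupType.
Implicit Types G H K : {group gT}.

Definition subgroup_orders G : seq nat := [seq #|G| %/ m | m <- subgroup_indices G].

Lemma subgroup_indicesP G m :
  reflect (exists2 H : {group gT}, H \subset G & m = #|G : H|) (m \in subgroup_indices G).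
Proof.
rewrite mem_undup; apply: (iffP imageP) => -[H]; first by rewrite inE; exists H.
by move=> sHG ->; exists H; rewrite ?inE.
Qed.

Lemma subgroup_ordersP G d :
  reflect (exists2 H : {group gT}, H \subset G & d = #|H|) (d \in subgroup_orders G).
Proof.
have E (H : {group gT}) : H \subset G -> #|G| %/ #|G : H| = #|H|.
  by move=> sHG; rewrite -(Lagrange sHG) mulnK.
apply: (iffP mapP) => [[m /subgroup_indicesP[H sHG ->] ->]|[H sHG ->]].
  by exists H; rewrite ?E.
by exists #|G : H|; rewrite ?E //; apply/subgroup_indicesP; exists H.
Qed.

Lemma subgroup_orders_uniq G : uniq (subgroup_orders G).
Proof.
rewrite map_inj_in_uniq ?undup_uniq // => x y /subgroup_indicesP[H sH ->] /subgroup_indicesP[K sK ->].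
have E (L : {group gT}) : L \subset G -> #|G| %/ #|G : L| = #|L|.
  by move=> sLG; rewrite -(Lagrange sLG) mulnK.
rewrite !E // => eHK; apply/eqP; rewrite -(@eqn_pmul2l #|H|) //.
by rewrite {2}eHK !Lagrange.
Qed.

Lemma J_orders G : J G = ((\sum_(d <- subgroup_orders G) d)%:R / #|G|%:R)%R.
Proof.
rewrite /J big_map GRing.natr_sum GRing.mulr_suml; apply: eq_big_seq => m /subgroup_indicesP[H sHG ->].
have H0 : (#|H|%:R != 0 :> rat)%R by rewrite Num.Theory.pnatr_eq0 -lt0n.
have i0 : (#|G : H|%:R != 0 :> rat)%R by rewrite Num.Theory.pnatr_eq0 -lt0n.
by rewrite -(Lagrange sHG) mulnK // GRing.natrM GRing.invfM GRing.mulrA (GRing.mulfV H0) GRing.mul1r.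
Qed.

(** Were all indices different, [G] and the given subgroups would have different
    orders; those of the subgroups add up to [#|G|]. *)
Lemma HS_of_orders G : \sum_(d <- subgroup_orders G) d < 2 * #|G| -> HS G.
Proof.
move=> small k H x k2 pr xG dis cov.
have [/existsP[i /existsP[j /andP[ij /eqP E]]]|] :=
  boolP [exists i, exists j, (i != j) && (#|G : H i| == #|G : H j|)]; first by exists i, j.
rewrite negb_exists => /forallP nE; exfalso; move: small; apply/negP; rewrite -leqNgt.
have sHG i : H i \subset G := proper_sub (pr i).
have inj : injective (fun i => #|H i|).
  move=> i j E; apply/eqP; have := nE i; rewrite negb_exists => /forallP/(_ j).
  by rewrite negb_and negbK -!divgS // E eqxx orbF.
have sumH : \sum_(i < k) #|H i| = #|G|.
  rewrite -[in RHS]cov -sum1_card partition_disjoint_bigcup //=.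
  by apply: eq_bigr => i _; rewrite sum1_card card_rcoset.
have uL : uniq (#|G| :: [seq #|H i| | i <- enum 'I_k]).
  rewrite /= map_inj_uniq // enum_uniq andbT; apply/mapP=> -[i _ E].
  by have := proper_card (pr i); rewrite E ltnn.
have := @sum_uniq_sub _ id _ (subgroup_orders G) uL _.
rewrite big_cons big_map big_enum /= sumH mul2n -addnn; apply.
move=> d; rewrite inE => /orP[/eqP->|/mapP[i _ ->]]; apply/subgroup_ordersP.
  by exists G.
by exists (H i).
Qed.

End Orders.

Section SymAlt.

Variable n : nat.
Hypothesis n4 : 4 < n.

Let cn : #|'I_n| = n := card_ord n.

Lemma Sym_orders_within : orders_within 'I_n 1 (subgroup_orders 'Sym_('I_n)%G).
Proof. by move=> d /subgroup_ordersP[H _ ->]; exists H. Qed.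

Lemma Alt_orders_within : orders_within 'I_n 2 (subgroup_orders 'Alt_('I_n)%G).
Proof. by move=> d /subgroup_ordersP[H sH ->]; exists H. Qed.

Lemma orders_sum_lt (c : nat) s : (c == 1) || (c == 2) -> uniq s -> orders_within 'I_n c s ->
  if c == 1 then (if n < 7 then 2 * \sum_(d <- s) d < 5 * n`! else \sum_(d <- s) d < 2 * n`!)
  else if n < 9 then 12 * \sum_(d <- s) d < 11 * n`! else 6 * \sum_(d <- s) d < 4 * n`!.
Proof.
move=> c12 us os; have [n25|n25] := leqP n 25; last first.
  have := @large_degree_sum 'I_n c s; rewrite cn => /(_ n25 c12 us os).
  have [-> ->] : (n < 7) = false /\ (n < 9) = false by split; lia.
  by [].
have cb : check_bound c n.
  have := allP check_bound_true n; rewrite mem_iota => /(_ (ltac:(lia))) /andP[b1 b2].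
  by case/orP: c12 => /eqP->.
have [facs bd] := andP cb.
have := @order_sum_bounded 'I_n c s c12; rewrite cn => /(_ facs n4 us os) le.
move: bd; have f := factN_nat n.
case: ifP => _; case: ifP => _ /N.ltb_lt; lia.
Qed.

End SymAlt.

(** * Degrees three and four *)

Lemma ratio_lt (a b p q : nat) : 0 < b -> 0 < q ->
  ((a%:R / b%:R < p%:R / q%:R :> rat) = (a * q < p * b)%N)%R.
Proof.
move=> b0 q0; rewrite Num.Theory.ltr_pdivrMr ?Num.Theory.ltr0n // GRing.mulrAC.
by rewrite Num.Theory.ltr_pdivlMr ?Num.Theory.ltr0n // -!GRing.natrM Num.Theory.ltr_nat.
Qed.

Lemma ratio_eq (a b p q : nat) : 0 < b -> 0 < q -> (a * q = p * b)%N ->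
  (a%:R / b%:R = p%:R / q%:R :> rat)%R.
Proof.
move=> b0 q0 E; apply/eqP.
by rewrite GRing.eqr_div ?Num.Theory.pnatr_eq0 -?lt0n // -!GRing.natrM E.
Qed.

Lemma J_lt (gT : finGroupType) (G : {group gT}) (p q : nat) : 0 < q ->
  (\sum_(d <- subgroup_orders G) d) * q < p * #|G| -> (J G < p%:R / q%:R)%R.
Proof. by move=> q0 lt; rewrite J_orders ratio_lt. Qed.

Lemma orders_sub_divisors (gT : finGroupType) (G : {group gT}) :
  {subset subgroup_orders G <= divisors #|G|}.
Proof.
move=> d /subgroup_ordersP[H sHG ->].
by rewrite -dvdn_divisors // cardSg.
Qed.

Lemma card_Sym_ord n : #|'Sym_('I_n)| = n`!.
Proof. by rewrite card_Sym card_ord. Qed.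

Lemma card_Alt_ord n : 1 < n -> 2 * #|'Alt_('I_n)| = n`!.
Proof. by move=> n1; rewrite card_Alt card_ord. Qed.

Lemma sum_orders_perm (gT : finGroupType) (G : {group gT}) (L : seq nat) : uniq L ->
  subgroup_orders G =i L -> \sum_(d <- subgroup_orders G) d = \sum_(d <- L) d.
Proof.
by move=> uL E; apply: perm_big; apply: uniq_perm (subgroup_orders_uniq G) uL E.
Qed.

(** A Sylow subgroup has normal subgroups of all orders dividing its own. *)
Lemma pgroup_order (gT : finGroupType) (G : {group gT}) p e : prime p -> p ^ e %| #|G| ->
  p ^ e \in subgroup_orders G.
Proof.
move=> pp dv; have [P sylP] := Sylow_exists p G.
have le : e <= logn p #|P|.
  by rewrite (card_Hall sylP) logn_part -pfactor_dvdn ?cardG_gt0.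
have [Q [sQP _ cQ]] := normal_pgroup (pHall_pgroup sylP) (normal_refl P) le.
by apply/subgroup_ordersP; exists Q; rewrite ?cQ // (subset_trans sQP (pHall_sub sylP)).
Qed.

Lemma full_order (gT : finGroupType) (G : {group gT}) : #|G| \in subgroup_orders G.
Proof. by apply/subgroup_ordersP; exists G. Qed.

Lemma Sym4_orders : \sum_(d <- subgroup_orders 'Sym_('I_4)%G) d = 60.
Proof.
have c4 := card_Sym_ord 4; rewrite (sum_orders_perm (divisors_uniq 24)); first by rewrite unlock.
move=> d; apply/idP/idP; first by move/orders_sub_divisors; rewrite c4.
have pg p e : prime p -> p ^ e %| 24 -> p ^ e \in subgroup_orders 'Sym_('I_4)%G.
  by move=> pp dv; apply: pgroup_order => //; rewrite c4.
have o6 : 6 \in subgroup_orders 'Sym_('I_4)%G.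
  apply/subgroup_ordersP; exists (perm.Sym_group [set~ ord0 : 'I_4]); first exact: subsetT.
  by rewrite perm.card_Sym cardsC1 card_ord.
have o12 : 12 \in subgroup_orders 'Sym_('I_4)%G.
  apply/subgroup_ordersP; exists 'Alt_('I_4)%G; first exact: subsetT.
  by apply/eqP; rewrite -(@eqn_pmul2l 2) // card_Alt_ord.
have o24 : 24 \in subgroup_orders 'Sym_('I_4)%G.
  by rewrite -[24]/(4`!) -c4 full_order.
rewrite (_ : divisors 24 = [:: 1; 2; 3; 4; 6; 8; 12; 24]) // !inE.
have := (pg 2 0 isT isT, pg 2 1 isT isT, pg 3 1 isT isT, pg 2 2 isT isT, pg 2 3 isT isT).
move=> [[[[o1 o2] o3] o4] o8].
by do 7 (case/orP; first by move/eqP=> ->); move/eqP=> ->.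
Qed.

(** The alternating group of degree 4 has no subgroup of order 6: such a subgroup
    contains a three-cycle, as 9 does not divide 24, but it is too small for
    its class to have four points and too large to fix a point. *)
Lemma Alt4_no6 : 6 \notin subgroup_orders 'Alt_('I_4)%G.
Proof.
apply/negP=> /subgroup_ordersP[H sH c6].
have cH : within 2 H by rewrite /within sH.
have c4 := card_ord 4.
have := class_trichotomy cH; rewrite c4 -c6; case.
- move=> free; have := free_dvd3 cH free; rewrite c4 -c6 => /(_ isT).
  by [].
- by case=> -[|[|[|[|[|k]]]]] [].
by case=> [[|[|[|e]]]] [m [j [[e2 e4]]]].
Qed.

Lemma Alt4_orders : \sum_(d <- subgroup_orders 'Alt_('I_4)%G) d = 22.
Proof.
have c4 : #|'Alt_('I_4)| = 12 by have := @card_Alt_ord 4 isT; rewrite -[4`!]/24; lia.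
rewrite (@sum_orders_perm _ _ [:: 1; 2; 3; 4; 12]) //; first by rewrite unlock.
move=> d; apply/idP/idP => [dO|].
  have := orders_sub_divisors dO; rewrite c4 (_ : divisors 12 = [:: 1; 2; 3; 4; 6; 12]) //.
  have : d != 6 by apply: contraTneq dO => ->; apply: Alt4_no6.
  by rewrite !inE => /negPf->.
have pg p e : prime p -> p ^ e %| 12 -> p ^ e \in subgroup_orders 'Alt_('I_4)%G.
  by move=> pp dv; apply: pgroup_order => //; rewrite c4.
have o12 : 12 \in subgroup_orders 'Alt_('I_4)%G by rewrite -{1}c4 full_order.
have := (pg 2 0 isT isT, pg 2 1 isT isT, pg 3 1 isT isT, pg 2 2 isT isT).
move=> [[[o1 o2] o3] o4]; rewrite !inE.
by do 4 (case/orP; first by move/eqP=> ->); move/eqP=> ->.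
Qed.

Lemma Sym3_orders : \sum_(d <- subgroup_orders 'Sym_('I_3)%G) d <= 12.
Proof.
have := sum_uniq_sub id (subgroup_orders_uniq 'Sym_('I_3)%G) (@orders_sub_divisors _ _).
by rewrite card_Sym_ord => /leq_trans; apply; rewrite unlock.
Qed.

Lemma Alt3_orders : \sum_(d <- subgroup_orders 'Alt_('I_3)%G) d <= 4.
Proof.
have c3 : #|'Alt_('I_3)| = 3 by have := @card_Alt_ord 3 isT; rewrite -[3`!]/6; lia.
have := sum_uniq_sub id (subgroup_orders_uniq 'Alt_('I_3)%G) (@orders_sub_divisors _ _).
by rewrite c3 => /leq_trans; apply; rewrite unlock.
Qed.

(** * The symmetric and alternating groups *)

Lemma Sym_sum n : 4 < n ->
  if n < 7 then 2 * \sum_(d <- subgroup_orders 'Sym_('I_n)%G) d < 5 * n`!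
  else \sum_(d <- subgroup_orders 'Sym_('I_n)%G) d < 2 * n`!.
Proof.
by move=> n4; have := @orders_sum_lt n n4 1 _ isT (subgroup_orders_uniq _) (@Sym_orders_within n).
Qed.

Lemma Alt_sum n : 4 < n ->
  if n < 9 then 12 * \sum_(d <- subgroup_orders 'Alt_('I_n)%G) d < 11 * n`!
  else 6 * \sum_(d <- subgroup_orders 'Alt_('I_n)%G) d < 4 * n`!.
Proof.
by move=> n4; have := @orders_sum_lt n n4 2 _ isT (subgroup_orders_uniq _) (@Alt_orders_within n).
Qed.

Import Order.TTheory GRing.Theory Num.Theory.
Local Open Scope ring_scope.

Lemma J_Sym4 : J 'Sym_('I_4)%G = 5 / 2.
Proof. by rewrite J_orders Sym4_orders card_Sym_ord; apply: ratio_eq. Qed.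

Lemma J_Alt4 : J 'Alt_('I_4)%G = 11 / 6.
Proof.
rewrite J_orders Alt4_orders; apply: ratio_eq => //.
by apply/eqP; rewrite -(@eqn_pmul2l 2) // [X in _ == X]mulnCA card_Alt_ord.
Qed.

Lemma J_Sym_lt n : (2 < n)%N -> n != 4%N -> J 'Sym_('I_n)%G < 5 / 2.
Proof.
move=> n2 n4; apply: J_lt => //; rewrite card_Sym_ord.
have [n3|n3] := leqP n 3.
  have -> : n = 3%N by apply/eqP; rewrite eqn_leq n3 n2.
  by apply: leq_ltn_trans (leq_mul Sym3_orders (leqnn 2)) _.
have {n2 n3 n4} n4 : (4 < n)%N by rewrite ltn_neqAle eq_sym n4.
have := Sym_sum n4; case: ifP => _; first by rewrite mulnC.
by have := fact_gt0 n; lia.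
Qed.

Lemma J_Sym_lt2 n : (6 < n)%N -> J 'Sym_('I_n)%G < 2.
Proof.
move=> n6; rewrite -[2]divr1; apply: (@J_lt _ _ 2 1) => //; rewrite card_Sym_ord muln1.
have n4 : (4 < n)%N by apply: ltn_trans n6.
by have := Sym_sum n4; rewrite ltnNge n6.
Qed.

Lemma J_Alt_lt n : (2 < n)%N -> n != 4%N -> J 'Alt_('I_n)%G < 11 / 6.
Proof.
move=> n2 n4; apply: J_lt => //.
rewrite -(@ltn_pmul2l 2) // [X in (_ < X)%N]mulnCA (card_Alt_ord (ltnW n2)).
have [n3|n3] := leqP n 3.
  have -> : n = 3%N by apply/eqP; rewrite eqn_leq n3 n2.
  by have := Alt3_orders; rewrite -[3`!]/6%N; lia.
have {n2 n3 n4} n4 : (4 < n)%N by rewrite ltn_neqAle eq_sym n4.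
have := Alt_sum n4; case: ifP => _; first by lia.
by have := fact_gt0 n; lia.
Qed.

Lemma J_Alt_lt43 n : (8 < n)%N -> J 'Alt_('I_n)%G < 4 / 3.
Proof.
move=> n8; apply: J_lt => //; have n4 : (4 < n)%N by apply: ltn_trans n8.
rewrite -(@ltn_pmul2l 2) // [X in (_ < X)%N]mulnCA card_Alt_ord; last exact: ltn_trans n4.
by have := Alt_sum n4; rewrite ltnNge n8 /=; lia.
Qed.

Lemma HS_of_J_lt2 (gT : finGroupType) (G : {group gT}) : J G < 2 -> HS G.
Proof.
rewrite -[2]divr1 J_orders => h; apply: HS_of_orders.
by move: h; rewrite (@ratio_lt _ _ 2 1) // muln1.
Qed.

Lemma HS_Alt_of_J n : J 'Alt_('I_n)%G <= 11 / 6 -> HS 'Alt_('I_n)%G.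
Proof.
move=> le; apply: HS_of_J_lt2; apply: le_lt_trans le _.
by rewrite -[2]divr1 (ratio_lt 11 2 (isT : (0 < 6)%N) (isT : (0 < 1)%N)).
Qed.

Theorem proposition3p2 (n : nat) (hn : (3 <= n)%N) :
  [/\ J 'Sym_('I_n)%G <= 5 / 2,
      J 'Sym_('I_n)%G = 5 / 2 <-> n = 4%N
    & (7 <= n)%N -> J 'Sym_('I_n)%G < 2] /\
  [/\ J 'Alt_('I_n)%G <= 11 / 6,
      J 'Alt_('I_n)%G = 11 / 6 <-> n = 4%N,
      (9 <= n)%N -> J 'Alt_('I_n)%G < 4 / 3
    & HS 'Alt_('I_n)%G].
Proof.
have [-> {n hn}|n4] := eqVneq n 4%N.
  have S := J_Sym4; have A := J_Alt4; split; split.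
  - by rewrite S lexx.
  - by rewrite S.
  - by [].
  - by rewrite A lexx.
  - by rewrite A.
  - by [].
  by apply: HS_Alt_of_J; rewrite A lexx.
have S := J_Sym_lt hn n4; have A := J_Alt_lt hn n4.
split; split.
- exact: ltW.
- by split=> [E|E]; [rewrite E ltxx in S | rewrite E in n4].
- exact: J_Sym_lt2.
- exact: ltW.
- by split=> [E|E]; [rewrite E ltxx in A | rewrite E in n4].
- exact: J_Alt_lt43.
by apply: HS_Alt_of_J; apply: ltW.
Qed.
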